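(* Let $\nu\in(0,1)$ and $\alpha\in(0,1]$. Let $\mathcal{N}^\nu$ be the fractional nonlinear pure birth process with pairwise distinct rates $\lambda_k>0$, $k\ge1$, and one progenitor, and let $\mathcal{S}^\alpha(t)$ be the $\alpha$-stable subordinator, with $\mathbb{E}e^{-z\mathcal{S}^\alpha(t)}=e^{-tz^\alpha}$, independent of $\mathcal{N}^\nu$. Then for all $t>0$ and $k\ge1$, $$\Pr\{\mathcal{N}^\nu(\mathcal{S}^\alpha(t))=k\mid\mathcal{N}^\nu(0)=1\}=\prod_{j=1}^{k-1}\lambda_j\sum_{m=1}^k\frac{1}{\prod_{l=1,l\neq m}^k(\lambda_l-\lambda_m)}\,\mathbb{E}\,e^{-t\lambda_m^{\alpha/\nu}\mathcal{W}_\alpha},$$ where $\mathcal{W}_\alpha$ is a random variable with density $$f_{\mathcal{W}_\alpha}(w)=\frac{\sin\nu\pi}{\alpha\pi}\,\frac{w^{\nu/\alpha-1}}{w^{2\nu/\alpha}+2w^{\nu/\alpha}\cos\nu\pi+1},\qquad w>0.$$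
   Context: The fractional process $\mathcal{N}^\nu$ has state probabilities $\Pr\{\mathcal{N}^\nu(t)=1\}=E_{\nu,1}(-\lambda_1t^\nu)$ and, for $k>1$, $\Pr\{\mathcal{N}^\nu(t)=k\}=\prod_{j=1}^{k-1}\lambda_j\sum_{m=1}^k\frac{E_{\nu,1}(-\lambda_mt^\nu)}{\prod_{l=1,l\ne m}^k(\lambda_l-\lambda_m)}$, where $E_{\nu,1}(x)=\sum_{h\ge0}x^h/\Gamma(\nu h+1)$ is the Mittag--Leffler function; it is assumed that $\sum_k1/\lambda_k=\infty$. Empty products equal $1$. *)

(* Defs.v *)
From HB Require Import structures.
From mathcomp Require Import all_boot all_order all_algebra.
From mathcomp Require Import all_classical all_reals all_analysis.
Set Implicit Arguments.
Unset Strict Implicit.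
Unset Printing Implicit Defensive.
Import Order.TTheory GRing.Theory Num.Theory.
Import numFieldNormedType.Exports.
Local Open Scope classical_set_scope.
Local Open Scope ring_scope.

Definition Gamma (R : realType) (x : R) : R :=
  \int[lebesgue_measure]_(u in `]0, +oo[) (u `^ (x - 1) * expR (- u)).

(* E_{nu,1}; for nu > 0 the series converges at every x. *)
Definition mittag_leffler (R : realType) (nu x : R) : R :=
  limn (series (fun h : nat => x ^+ h / Gamma (nu * h%:R + 1))).

(* Elementary conditional probability P(A | B), meaningful when P B > 0. *)
Definition cond_prob (d : measure_display) (T : measurableType d)
    (R : realType) (P : probability T R) (A B : set T) : R :=
  fine (P (A `&` B)) / fine (P B).

Definition has_density (d : measure_display) (T : measurableType d)
    (R : realType) (P : probability T R) (X : {RV P >-> R}) (f : R -> R) :=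
  forall A : set R, measurable A ->
    distribution P X A = (\int[lebesgue_measure]_(x in A) (f x)%:E)%E.

Definition is_pdf (R : realType) (f : R -> R) :=
  [/\ measurable_fun [set: R] f, forall x, 0 <= f x &
      (\int[lebesgue_measure]_x (f x)%:E = 1)%E].

(* A process is a family of random variables indexed by R, of which only the
   times t >= 0 are ever used. *)

Definition process_sigma (d d' : measure_display) (T : measurableType d)
    (E : measurableType d') (R : realType) (X : R -> {mfun T >-> E})
    : set (set T) :=
  <<s [set A | exists2 t : R, 0 <= t &
               exists2 B : set E, measurable B & A = X t @^-1` B] >>.

Definition independent_processes (d d1 d2 : measure_display)
    (T : measurableType d) (E1 : measurableType d1) (E2 : measurableType d2)
    (R : realType) (P : probability T R)
    (X : R -> {mfun T >-> E1}) (Y : R -> {mfun T >-> E2}) :=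
  forall A B : set T, process_sigma X A -> process_sigma Y B ->
    (P (A `&` B) = P A * P B)%E.

(* Taking some of the A i to be the whole line gives the product rule for every
   subfamily of the increments. *)
Definition independent_increments (d : measure_display) (T : measurableType d)
    (R : realType) (P : probability T R) (X : R -> {mfun T >-> R}) :=
  forall (n : nat) (t : nat -> R) (A : nat -> set R),
    0 <= t 0%N -> {homo t : i j / (i <= j)%N >-> i <= j} ->
    (forall i, measurable (A i)) ->
    (P (\bigcap_(i < n) [set w | A i (X (t i.+1) w - X (t i) w)%R])
     = \prod_(i < n) P [set w | A i (X (t i.+1) w - X (t i) w)%R])%E.

Definition stationary_increments (d : measure_display) (T : measurableType d)
    (R : realType) (P : probability T R) (X : R -> {mfun T >-> R}) :=
  forall (s t : R) (A : set R), 0 <= s -> 0 <= t -> measurable A ->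
    P [set w | A (X (s + t) w - X s w)] = P [set w | A (X t w)].

Record stable_subordinator (d : measure_display) (T : measurableType d)
    (R : realType) (P : probability T R) (alpha : R)
    (S : R -> {mfun T >-> R}) : Prop := {
  subordinator_start : forall w, S 0 w = 0;
  subordinator_nondecreasing :
    forall w (s t : R), 0 <= s -> s <= t -> S s w <= S t w;
  subordinator_right_continuous :
    forall w (t : R), 0 <= t -> (fun s => S s w) @ t^'+ --> S t w;
  subordinator_independent_increments : independent_increments P S;
  subordinator_stationary_increments : stationary_increments P S;
  subordinator_laplace : forall t z : R, 0 <= t -> 0 <= z ->
    'E_P[fun w => expR (- (z * S t w))]%E = (expR (- (t * z `^ alpha)))%:E
}.

(* Pr{N^nu(t) = k}, for k >= 1; at k = 1 all the products are empty. *)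
Definition birth_prob (R : realType) (nu : R) (lambda : nat -> R) (t : R)
    (k : nat) : R :=
  \prod_(1 <= j < k) lambda j *
  \sum_(1 <= m < k.+1)
    mittag_leffler nu (- (lambda m * t `^ nu)) /
    \prod_(1 <= l < k.+1 | l != m) (lambda l - lambda m).

(* One progenitor, births one at a time, right-continuous paths (which give
   meaning to N evaluated at a random time) and the one-dimensional laws
   birth_prob. *)
Record fractional_pure_birth (d : measure_display) (T : measurableType d)
    (R : realType) (P : probability T R) (nu : R) (lambda : nat -> R)
    (N : R -> {mfun T >-> nat}) : Prop := {
  birth_start : P [set w | N 0 w = 1%N] = 1%E;
  birth_nondecreasing :
    forall w (s t : R), 0 <= s -> s <= t -> (N s w <= N t w)%N;
  birth_right_continuous :
    forall w (t : R), 0 <= t -> \forall s \near t^'+, N s w = N t w;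
  birth_one_by_one : forall w (t : R) k, 0 <= t -> (N 0%R w <= k <= N t w)%N ->
    exists2 s : R, 0 <= s <= t & N s w = k;
  birth_state_probabilities : forall (t : R) k, 0 < t -> (1 <= k)%N ->
    P [set w | N t w = k] = (birth_prob nu lambda t k)%:E
}.

Definition W_density (R : realType) (nu alpha w : R) : R :=
  if 0 < w then
    sin (nu * pi) / (alpha * pi) *
    (w `^ (nu / alpha - 1) /
     (w `^ (2 * nu / alpha) + 2 * w `^ (nu / alpha) * cos (nu * pi) + 1))
  else 0.

(* Main.v *)
Require Import Defs.
From HB Require Import structures.
From mathcomp Require Import all_boot all_order all_algebra.
From mathcomp Require Import all_classical all_reals all_analysis.
From mathcomp Require Import measurable_realfun ring lra.
Set Implicit Arguments.
Unset Strict Implicit.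
Unset Printing Implicit Defensive.
Import Order.TTheory GRing.Theory Num.Theory.
Import numFieldNormedType.Exports.
Local Open Scope classical_set_scope.
Local Open Scope ring_scope.

(** Partial fractions do the combinatorics: once [b(s) := birth_prob nu lambda s k]
    is known, the marginal law at the random time is [E b(S_t)], a finite linear
    combination of the numbers [E E_{nu,1}(- lambda_m S_t^nu)].  The analytic
    core is the spectral representation
      [E_{nu,1}(- x^nu) = \int e^{- x e^r} k(r) dr],  [x >= 0],
    with [k] a probability density on the whole line, [r] being the logarithm of
    the frequency.  Both sides have the Laplace transform
    [s^{nu-1} / (s^nu + 1)]: on the left termwise, on the right by evaluating the
    Stieltjes transform of [k], which follows from integrating
    [1 / ((1 + c e^{- nu z}) (1 - e^z))] along [Im z = pi] and letting the contour
    descend to the pole at [z = 0].  Laplace transforms determine continuous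
    integrable functions.  Tonelli and [E e^{- z S_t} = e^{- t z^alpha}] then give
      [E E_{nu,1}(- lambda S_t^nu) = \int exp (- t lambda^{alpha/nu} e^{alpha r}) k(r) dr],
    and [w = e^{alpha r}] carries [k] to the density of [W_alpha]. *)

(** * Contour shifting in a strip *)

Section strip.
Variable R : realType.
Implicit Types (U V G : R -> R -> R).
Local Notation mu := (@lebesgue_measure R).

(** Taking the logarithm of the frequency opens the keyhole contour around the cut of [xi^nu] into
    horizontal lines and turns dilation into translation; the constant [c] records that translation.
    The contour is moved in real terms: the integral along [Im z = th] is a parameter integral in
    [th], and Cauchy-Riemann reduces its derivative to values on the vertical sides, of order
    [e^{- n}] on the right and [e^{- nu n}] on the left. The line cannot reach [Im z = 0], where the
    pole sits. Near it the integrand is a bounded remainder, vanishing in the limit, plus a multiple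
    of a Poisson-like kernel with an arctangent primitive, whose mass tends to [pi]: half a residue.
    The termwise transform of the Mittag-Leffler function is available for [s > 1], where a
    geometric series converges, so uniqueness is drawn from [s = 2, 3, ...] alone: these are moments
    in [e^{- x}]. The law of [S_t] is known only through its Laplace transform, and independence
    only event by event; right-continuity lets the random time be approached by times with countably
    many values. *)

Lemma derivable_continuous (f : R -> R) (x : R) : derivable f x 1 -> {for x, continuous f}.
Proof. by move=> /derivable1_diffP/differentiable_continuous. Qed.

Lemma is_derive_FTC2 (F f : R -> R) a b : a < b ->
  {within `[a, b], continuous f} ->
  (forall x, a <= x <= b -> is_derive x 1 F (f x)) ->
  \int[mu]_(x in `[a, b]) f x = F b - F a.
Proof.
move=> ab cf dF; rewrite /Rintegral (continuous_FTC2 ab cf (F := F)) //.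
- have cF x : a <= x <= b -> {for x, continuous F}.
    by move=> xab; apply: derivable_continuous; case: (dF _ xab).
  split.
  + by move=> x /[!in_itv]/= /andP[ax xb]; case: (dF x) => //; rewrite !ltW.
  + by apply: cvg_at_right_filter; apply: cF; rewrite lexx ltW.
  + by apply: cvg_at_left_filter; apply: cF; rewrite lexx ltW.
- move=> x /[!in_itv]/= /andP[ax xb]; rewrite derive1E.
  by apply: (@derive_val _ _ _ _ _ _ _ (dF x _)); rewrite !ltW.
Qed.

(* [U] and [V] play the imaginary and real parts of a holomorphic function of
   [r + i th] and [G] the real part of its derivative: Cauchy-Riemann turns the
   variation of the integral along [Im = th] into boundary terms. *)
Lemma Rintegral_shift_le U V G (a b u v eps C : R) : a < b ->
  (forall r th : R, a <= r <= b -> u < th < v -> is_derive th 1 (U r) (G r th)) ->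
  (forall r th : R, a <= r <= b -> u < th < v -> is_derive r 1 (V^~ th) (G r th)) ->
  (forall r th : R, a <= r <= b -> u < th < v -> `|G r th| <= C) ->
  (forall th : R, u < th < v -> {within `[a, b], continuous (U^~ th)}) ->
  (forall th : R, u < th < v -> {within `[a, b], continuous (G^~ th)}) ->
  (forall th : R, u < th < v -> `|V b th - V a th| <= eps) ->
  forall th1 th2 : R, u < th1 -> th1 < th2 -> th2 < v ->
  `|\int[mu]_(r in `[a, b]) U r th2 - \int[mu]_(r in `[a, b]) U r th1|
    <= eps * (th2 - th1).
Proof.
move=> ab dU dV GC cU cG Veps th1 th2 uth1 th12 th2v.
pose J th := \int[mu]_(r in `[a, b]) U r th.
have iU th : `]u, v[%classic th -> mu.-integrable `[a, b] (EFin \o U ^~ th).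
  rewrite /= in_itv/= => uv; apply: continuous_compact_integrable; last exact: cU.
  exact: segment_compact.
have uvP th : th1 <= th <= th2 -> `]u, v[%classic th.
  by rewrite /= in_itv/=; lra.
have C0 : 0 <= C.
  apply: le_trans (GC a th1 _ _); first exact: normr_ge0.
    by rewrite lexx ltW.
  by rewrite uth1; lra.
have iC : mu.-integrable `[a, b] (EFin \o cst C).
  apply: continuous_compact_integrable; first exact: segment_compact.
  by apply: continuous_subspaceT => x; exact: cvg_cst.
have derU x y : `]u, v[%classic x -> `[a, b]%classic y -> derivable (U y) x 1.
  rewrite /= !in_itv/= => xuv yab; by case: (dU y x yab xuv).
have ubU x y : `]u, v[%classic x -> `[a, b]%classic y ->
    `|partial1of2 (fun th r => U r th) x y| <= C.
  rewrite /= !in_itv/= => xuv yab; rewrite partial1of2E.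
  rewrite (@derive_val _ _ _ _ _ _ _ (dU y x yab xuv)); exact: GC.
have dJ th : th1 <= th <= th2 ->
    is_derive th 1 J (V b th - V a th).
  move=> thP; have Ith := uvP _ thP.
  have := @derivable_under_integral R _ _ mu (fun th r => U r th) `[a,b]%classic
    (measurable_itv _) th u v Ith iU derU (cst C) (fun=> C0) iC ubU.
  have := @differentiation_under_integral R _ _ mu (fun th r => U r th) `[a,b]%classic
    (measurable_itv _) th u v Ith iU derU (cst C) (fun=> C0) iC ubU.
  move=> e dr; apply: DeriveDef => //.
  rewrite -derive1E [LHS]e.
  have Ith' : u < th < v by move: Ith; rewrite /= in_itv.
  have <- := @is_derive_FTC2 (V^~ th) (G^~ th) a b ab (cG _ Ith')
    (fun r rab => dV r th rab Ith').
  apply: eq_Rintegral => r; rewrite inE/= in_itv/= => rab.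
  by rewrite partial1of2E (@derive_val _ _ _ _ _ _ _ (dU r th rab Ith')).
have [c cth e] := @MVT R J _ th1 th2 th12
  (fun x xP => dJ x (ltac:(by move: xP; rewrite in_itv/= => /andP[? ?]; rewrite !ltW)))
  (ltac:(by apply: continuous_in_subspaceT => x; rewrite inE/= in_itv/= => xP;
     apply: derivable_continuous; case: (dJ _ xP))).
rewrite -/(J th2) -/(J th1) e normrM [`|th2 - th1|]gtr0_norm ?subr_gt0//.
apply: ler_wpM2r; first by rewrite subr_ge0 ltW.
apply: Veps.
by move: cth; rewrite in_itv/= => /andP[? ?]; lra.
Qed.

End strip.

(** * Differentiation and continuity rules for explicit expressions *)

Section derivation_rules.
Variable R : realType.
Implicit Types (f g : R -> R) (x a b : R).

Lemma der_cst x a : is_derive x 1 (fun _ : R => a) 0.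
Proof. exact: is_derive_cst. Qed.

Lemma der_id x : is_derive x 1 (fun t : R => t) 1.
Proof. exact: is_derive_id. Qed.

Lemma derD f g x a b : is_derive x 1 f a -> is_derive x 1 g b ->
  is_derive x 1 (fun t => f t + g t) (a + b).
Proof. by move=> ? ?; exact: is_deriveD. Qed.

Lemma derN f x a : is_derive x 1 f a -> is_derive x 1 (fun t => - f t) (- a).
Proof. by move=> ?; exact: is_deriveN. Qed.

Lemma derM f g x a b : is_derive x 1 f a -> is_derive x 1 g b ->
  is_derive x 1 (fun t => f t * g t) (f x * b + g x * a).
Proof. by move=> ? ?; exact: is_deriveM. Qed.

Lemma derV f x a : f x != 0 -> is_derive x 1 f a ->
  is_derive x 1 (fun t => (f t)^-1) (- (f x) ^- 2 * a).
Proof. by move=> ? ?; exact: is_deriveV. Qed.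

Lemma der_exp f x a : is_derive x 1 f a ->
  is_derive x 1 (fun t => expR (f t)) (expR (f x) * a).
Proof. by move=> ?; exact: (is_derive1_comp (is_derive_expR _)). Qed.

Lemma der_cos f x a : is_derive x 1 f a ->
  is_derive x 1 (fun t => cos (f t)) (- sin (f x) * a).
Proof. by move=> ?; exact: (is_derive1_comp (is_derive_cos _)). Qed.

Lemma der_sin f x a : is_derive x 1 f a ->
  is_derive x 1 (fun t => sin (f t)) (cos (f x) * a).
Proof. by move=> ?; exact: (is_derive1_comp (is_derive_sin _)). Qed.

Lemma der_atan f x a : is_derive x 1 f a ->
  is_derive x 1 (fun t => atan (f t)) ((1 + (f x) ^+ 2)^-1 * a).
Proof. by move=> ?; exact: (is_derive1_comp (is_derive1_atan _)). Qed.

End derivation_rules.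

(** The derivative is an existential variable filled in while the expression is traversed, and is
    identified afterwards by [ring] or [field]. Apart from leaves closed by assumption, only the
    non-vanishing of denominators is left. *)
Ltac der := cbv beta; lazymatch goal with
  | |- is_derive _ _ (fun _ => ?a) _ => exact: der_cst
  | |- is_derive _ _ (fun t => t) _ => exact: der_id
  | |- is_derive _ _ (fun t => _ + _) _ => apply: derD; der
  | |- is_derive _ _ (fun t => - _) _ => apply: derN; der
  | |- is_derive _ _ (fun t => _ * _) _ => apply: derM; der
  | |- is_derive _ _ (fun t => _^-1) _ => apply: derV; [|der]
  | |- is_derive _ _ (fun t => expR _) _ => apply: der_exp; der
  | |- is_derive _ _ (fun t => cos _) _ => apply: der_cos; der
  | |- is_derive _ _ (fun t => sin _) _ => apply: der_sin; der
  | |- is_derive _ _ (fun t => atan _) _ => apply: der_atan; der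
  | |- is_derive _ _ expR _ => exact: is_derive_expR
  | |- is_derive _ _ cos _ => exact: is_derive_cos
  | |- is_derive _ _ sin _ => exact: is_derive_sin
  | |- _ => try eassumption
  end.

Section continuity_rules.
Variables (R : realType) (T : topologicalType).
Implicit Types (f g : T -> R) (x : T).

Lemma ct_cst x (a : R) : {for x, continuous (fun _ : T => a)}.
Proof. exact: cvg_cst. Qed.

Lemma ctD f g x : {for x, continuous f} -> {for x, continuous g} ->
  {for x, continuous (fun t => f t + g t)}.
Proof. by move=> ? ?; exact: continuousD. Qed.

Lemma ctN f x : {for x, continuous f} -> {for x, continuous (fun t => - f t)}.
Proof. by move=> ?; exact: continuousN. Qed.

Lemma ctM f g x : {for x, continuous f} -> {for x, continuous g} ->
  {for x, continuous (fun t => f t * g t)}.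
Proof. by move=> ? ?; exact: continuousM. Qed.

Lemma ctX f n x : {for x, continuous f} -> {for x, continuous (fun t => f t ^+ n)}.
Proof. by move=> cf; exact: (continuous_comp cf (@exprn_continuous _ n _)). Qed.

Lemma ctV f x : f x != 0 -> {for x, continuous f} ->
  {for x, continuous (fun t => (f t)^-1)}.
Proof. by move=> ? ?; exact: continuousV. Qed.

Lemma ct_comp (h : R -> R) f x : continuous h -> {for x, continuous f} ->
  {for x, continuous (fun t => h (f t))}.
Proof. by move=> ch cf; exact: (continuous_comp cf (ch _)). Qed.

Lemma ct_exp f x : {for x, continuous f} -> {for x, continuous (fun t => expR (f t))}.
Proof. exact: (ct_comp (@continuous_expR R)). Qed.

Lemma ct_cos f x : {for x, continuous f} -> {for x, continuous (fun t => cos (f t))}.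
Proof. exact: (ct_comp (@continuous_cos R)). Qed.

Lemma ct_sin f x : {for x, continuous f} -> {for x, continuous (fun t => sin (f t))}.
Proof. exact: (ct_comp (@continuous_sin R)). Qed.

End continuity_rules.

Ltac ct := cbv beta; lazymatch goal with
  | |- continuous_at ?x ?f => change {for x, continuous f}; ct
  | |- {for _, continuous (fun _ => ?a)} => exact: ct_cst
  | |- {for _, continuous (fun t => t)} => exact: cvg_id
  | |- {for _, continuous fst} => exact: cvg_fst
  | |- {for _, continuous snd} => exact: cvg_snd
  | |- {for _, continuous ( *%R ?a)} => exact: (@mulrl_continuous _ a)
  | |- {for _, continuous -%R} => exact: opp_continuous
  | |- {for _, continuous expR} => exact: continuous_expR
  | |- {for _, continuous cos} => exact: continuous_cos
  | |- {for _, continuous sin} => exact: continuous_sin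
  | |- {for _, continuous (fun t => _ + _)} => apply: ctD; ct
  | |- {for _, continuous (fun t => - _)} => apply: ctN; ct
  | |- {for _, continuous (fun t => _ * _)} => apply: ctM; ct
  | |- {for _, continuous (fun t => _ ^+ _)} => apply: ctX; ct
  | |- {for _, continuous (fun t => _^-1)} => apply: ctV; [try eassumption|ct]
  | |- {for _, continuous (fun t => expR _)} => apply: ct_exp; ct
  | |- {for _, continuous (fun t => cos _)} => apply: ct_cos; ct
  | |- {for _, continuous (fun t => sin _)} => apply: ct_sin; ct
  | |- _ => try eassumption
  end.

(** * A Stieltjes integral, by lowering the contour to the pole *)

Section contour.
Variable R : realType.
Local Notation mu := (@lebesgue_measure R).
Variables nu c : R.
Hypotheses (nu0 : 0 < nu) (nu1 : nu < 1) (c0 : 0 < c).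

(* With [z = r + i th]: [AR + i AI = 1 + c e^{- nu z}], [BR + i BI = 1 - e^z],
   [DR + i DI] is their product, [ER + i EI] the derivative of that product,
   [NA], [NB], [N] are the squared moduli, and [V + i U] is the inverse of
   [DR + i DI], whose derivative has real part [G]. *)
Let AR (r th : R) : R := 1 + c * expR (- (nu * r)) * cos (nu * th).
Let AI (r th : R) : R := - (c * expR (- (nu * r)) * sin (nu * th)).
Let BR (r th : R) : R := 1 - expR r * cos th.
Let BI (r th : R) : R := - (expR r * sin th).
Let DR (r th : R) : R := AR r th * BR r th - AI r th * BI r th.
Let DI (r th : R) : R := AR r th * BI r th + AI r th * BR r th.
Let ER (r th : R) : R := - nu * (AR r th - 1) * BR r th + AR r th * (BR r th - 1)
              + nu * AI r th * BI r th - AI r th * BI r th.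
Let EI (r th : R) : R := - nu * (AR r th - 1) * BI r th + AR r th * BI r th
              - nu * AI r th * BR r th + AI r th * (BR r th - 1).
Let NA (r th : R) : R := AR r th ^+ 2 + AI r th ^+ 2.
Let NB (r th : R) : R := BR r th ^+ 2 + BI r th ^+ 2.
Let N (r th : R) : R := NA r th * NB r th.
Let U (r th : R) : R := - DI r th / N r th.
Let V (r th : R) : R := DR r th / N r th.
Let G (r th : R) : R := (ER r th * (DI r th ^+ 2 - DR r th ^+ 2)
               - 2 * DR r th * DI r th * EI r th) / N r th ^+ 2.

Let NE (r th : R) : N r th = DR r th ^+ 2 + DI r th ^+ 2.
Proof. by rewrite /N /NA /NB /DR /DI; ring. Qed.

Let dDRr (r th : R) : is_derive r 1 (DR^~ th) (ER r th).
Proof. by eapply is_derive_eq; [rewrite /DR /AR /AI /BR /BI; der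
  | rewrite /ER /AR /AI /BR /BI /GRing.scale /=; ring]. Qed.

Let dDIr (r th : R) : is_derive r 1 (DI^~ th) (EI r th).
Proof. by eapply is_derive_eq; [rewrite /DI /AR /AI /BR /BI; der
  | rewrite /EI /AR /AI /BR /BI /GRing.scale /=; ring]. Qed.

Let dDRt (r th : R) : is_derive th 1 (DR r) (- EI r th).
Proof. by eapply is_derive_eq; [rewrite /DR /AR /AI /BR /BI; der
  | rewrite /EI /AR /AI /BR /BI /GRing.scale /=; ring]. Qed.

Let dDIt (r th : R) : is_derive th 1 (DI r) (ER r th).
Proof. by eapply is_derive_eq; [rewrite /DI /AR /AI /BR /BI; der
  | rewrite /ER /AR /AI /BR /BI /GRing.scale /=; ring]. Qed.

Let NAE (r th : R) : NA r th =
  1 + 2 * (c * expR (- (nu * r))) * cos (nu * th) + (c * expR (- (nu * r))) ^+ 2.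
Proof.
rewrite /NA /AR /AI.
have := cos2Dsin2 (nu * th); move: (cos _) (sin _) (c * _) => C S x CS.
transitivity (1 + 2 * x * C + x ^+ 2 * (C ^+ 2 + S ^+ 2)); first by ring.
by rewrite CS mulr1.
Qed.

Let NBE (r th : R) : NB r th = 1 - 2 * expR r * cos th + expR r ^+ 2.
Proof.
rewrite /NB /BR /BI.
have := cos2Dsin2 th; move: (cos _) (sin _) (expR _) => C S x CS.
transitivity (1 - 2 * x * C + x ^+ 2 * (C ^+ 2 + S ^+ 2)); first by ring.
by rewrite CS mulr1.
Qed.

(** Reverse triangle inequality. It is uniform in [th], so the vertical sides can be estimated
    without following the angle. *)
Let NA_ge (r th : R) : (1 - c * expR (- (nu * r))) ^+ 2 <= NA r th.
Proof.
rewrite NAE; have := cos_geN1 (nu * th).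
have x0 : 0 < c * expR (- (nu * r)) by rewrite mulr_gt0// expR_gt0.
move: (cos _) (c * _) x0 => C x; nra.
Qed.

Let NB_ge (r th : R) : (1 - expR r) ^+ 2 <= NB r th.
Proof.
rewrite NBE; have := cos_le1 th; have := expR_gt0 r.
move: (cos _) (expR _) => C x; nra.
Qed.

(** The zeros of [1 + c e^{- nu z}] have [nu Im z] an odd multiple of [pi]. Since [nu < 1], the
    zero-free strip extends beyond the line [Im z = pi]. *)
Let NA_gt0 (r th : R) : 0 < th -> nu * th < pi -> 0 < NA r th.
Proof.
move=> t0 tpi; rewrite /NA /AI.
have : 0 < sin (nu * th) by rewrite sin_gt0_pi// tpi mulr_gt0.
have x0 : 0 < c * expR (- (nu * r)) by rewrite mulr_gt0// expR_gt0.
move=> s0; apply: ltr_wpDl; first exact: sqr_ge0.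
by rewrite sqrrN exprn_gt0// mulr_gt0.
Qed.

Let NB_gt0 (r th : R) : 0 < th -> th < 2 * pi -> 0 < NB r th.
Proof.
move=> t0 tpi; rewrite /NB /BI /BR.
have q0 := expR_gt0 r.
have [thpi|thpi] := eqVneq th pi.
  rewrite thpi cospi sinpi; move: (expR _) q0 => q; nra.
have s0 : sin th != 0.
  have [lt|gt] := ltP th pi; first by rewrite gt_eqF// sin_gt0_pi// t0 lt.
  have : 0 < sin (th - pi).
    have gt' : pi < th by rewrite lt_neqAle eq_sym thpi gt.
    by apply: sin_gt0_pi; apply/andP; split; lra.
  by rewrite sinB cospi sinpi mulr0 subr0 mulrN1 => h; rewrite lt_eqF// -oppr_gt0.
apply: ltr_wpDl; first exact: sqr_ge0.
by rewrite sqrrN exprn_even_gt0// mulf_neq0// gt_eqF.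
Qed.

Let N_gt0 (r th : R) : 0 < th -> th < 2 * pi -> nu * th < pi -> 0 < N r th.
Proof. by move=> *; rewrite /N mulr_gt0 ?NA_gt0 ?NB_gt0. Qed.

(** For [f = V + i U = 1 / D], the derivative along [th] is [i f'] and the derivative along [r] is
    [f']. As [Im (i f') = Re f'], the same [G] serves here and in [dV]. *)
Let dU (r th : R) : N r th != 0 -> is_derive th 1 (U r) (G r th).
Proof.
move=> N0; have N0' : DR r th ^+ 2 + DI r th ^+ 2 != 0 by rewrite -NE.
have -> : U r = fun t => - DI r t / (DR r t * DR r t + DI r t * DI r t).
  by apply/funext => t; rewrite /U NE !expr2.
have h1 := dDIt r th; have h2 := dDRt r th.
eapply is_derive_eq; first by der; rewrite -!expr2.
by rewrite /G NE /GRing.scale /=; field.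
Qed.

Let dV (r th : R) : N r th != 0 -> is_derive r 1 (V^~ th) (G r th).
Proof.
move=> N0; have N0' : DR r th ^+ 2 + DI r th ^+ 2 != 0 by rewrite -NE.
have -> : V^~ th = fun t => DR t th / (DR t th * DR t th + DI t th * DI t th).
  by apply/funext => t; rewrite /V NE !expr2.
have h1 := dDIr r th; have h2 := dDRr r th.
eapply is_derive_eq; first by der; rewrite -!expr2.
by rewrite /G NE /GRing.scale /=; field.
Qed.

Let V_le (r th M : R) : 0 < M ->
  M ^+ 2 <= ((1 - c * expR (- (nu * r))) * (1 - expR r)) ^+ 2 ->
  `|V r th| <= M^-1.
Proof.
move=> M0 MN.
have M2N : M ^+ 2 <= N r th.
  apply: (le_trans MN); rewrite exprMn; apply: ler_pM => //; rewrite sqr_ge0//.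
have N0 : 0 < N r th by apply: lt_le_trans M2N; rewrite exprn_gt0.
rewrite -ler_sqr ?nnegrE ?invr_ge0 ?(ltW M0)//.
rewrite real_normK ?num_real// exprVn /V expr_div_n.
rewrite ler_pdivrMr ?exprn_gt0//.
have : DR r th ^+ 2 <= N r th by rewrite NE lerDl sqr_ge0.
move=> /le_trans; apply.
rewrite expr2 mulrA ler_peMl ?(ltW N0)//.
by rewrite mulrC ler_pdivlMr ?mulr_gt0// mul1r -expr2.
Qed.

Let NJ_cont (q : R * R) : {for q, continuous (fun p : R * R => N p.1 p.2)}.
Proof. by rewrite /N /NA /NB /AR /AI /BR /BI; ct. Qed.

Let G_cont (q : R * R) : N q.1 q.2 != 0 ->
  {for q, continuous (fun p : R * R => G p.1 p.2)}.
Proof.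
move=> N0; have cN := @NJ_cont q.
have N2 : N q.1 q.2 ^+ 2 != 0 by rewrite expf_neq0.
by rewrite /G /DI /DR /ER /EI /AR /AI /BR /BI; ct.
Qed.

Let U_cont1 (r th : R) : N r th != 0 -> {for r, continuous (U^~ th)}.
Proof.
move=> N0; have cN : {for r, continuous (N^~ th)}.
  by rewrite /N /NA /NB /AR /AI /BR /BI; ct.
by rewrite /U /DI /AR /AI /BR /BI; ct.
Qed.

Let G_cont1 (r th : R) : N r th != 0 -> {for r, continuous (G^~ th)}.
Proof.
move=> N0; have cN : {for r, continuous (N^~ th)}.
  by rewrite /N /NA /NB /AR /AI /BR /BI; ct.
have N2 : N r th ^+ 2 != 0 by rewrite expf_neq0.
by rewrite /G /DI /DR /ER /EI /AR /AI /BR /BI; ct.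
Qed.

Let J (n : R) (th : R) := \int[mu]_(r in `[- n, n]) U r th.

Let J_le (n th M1 M2 : R) : 0 < n -> 0 < th < pi -> 0 < M1 -> 0 < M2 ->
  M1 ^+ 2 <= ((1 - c * expR (- (nu * n))) * (1 - expR n)) ^+ 2 ->
  M2 ^+ 2 <= ((1 - c * expR (nu * n)) * (1 - expR (- n))) ^+ 2 ->
  `|J n pi - J n th| <= (M1^-1 + M2^-1) * pi.
Proof.
move=> n0 /andP[th0 thpi] M10 M20 hM1 hM2.
(* The shift needs an open strip around [[th, pi]]. This [v] satisfies [pi < v < 2 pi] and
   [nu v < pi], so neither factor vanishes for heights in [[th / 2, v]], and compactness of the
   rectangle bounds [G]. *)
pose v := 2 * pi / (1 + nu) : R.
have pi0 : 0 < pi :> R := pi_gt0 R.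
have n0' := nu0; have n1' := nu1.
have nu1' : 0 < 1 + nu by lra.
have vpi : pi < v by rewrite /v ltr_pdivlMr//; nra.
have v2pi : v < 2 * pi by rewrite /v ltr_pdivrMr//; nra.
have nuv : nu * v < pi by rewrite /v mulrA ltr_pdivrMr//; nra.
have Nn0 r t : th / 2 <= t <= v -> N r t != 0.
  move=> /andP[h1 h2]; rewrite gt_eqF// N_gt0 //; [lra|lra|].
  by apply: le_lt_trans nuv; rewrite ler_wpM2l// ltW.
have [C HC] : exists C, forall r t, - n <= r <= n -> th / 2 <= t <= v -> `|G r t| <= C.
  have cK : compact (`[- n, n]%classic `*` `[th / 2, v]%classic : set (R * R)%type).
    by apply: compact_setX; exact: segment_compact.
  have cG : {within `[- n, n]%classic `*` `[th / 2, v]%classic,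
      continuous (fun p : R * R => G p.1 p.2)}.
    apply: continuous_in_subspaceT => -[r t]; rewrite inE/= !in_itv/= => -[_ ht].
    by apply: G_cont; exact: Nn0.
  have := compact_bounded (continuous_compact cG cK).
  move=> [M [Mr HM]]; exists (M + 1) => r t hr ht.
  apply: (HM (M + 1)); first by rewrite ltrDl.
  by exists (r, t) => //=; rewrite !in_itv.
have lt_le t : th / 2 < t < v -> th / 2 <= t <= v by move=> /andP[? ?]; rewrite !ltW.
have := @Rintegral_shift_le R U V G (- n) n (th / 2) v (M1^-1 + M2^-1)
  C _ _ _ _ _ _ _ th pi _ thpi vpi.
move=> h; apply: le_trans.
  apply: h; [lra| | | | | | |lra].
  - by move=> r t hr /lt_le ht; apply: dU; exact: Nn0.
  - by move=> r t hr /lt_le ht; apply: dV; exact: Nn0.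
  - by move=> r t hr /lt_le ht; exact: HC.
  - move=> t /lt_le ht; apply: continuous_subspaceT => r.
    by apply: U_cont1; exact: Nn0.
  - move=> t /lt_le ht; apply: continuous_subspaceT => r.
    by apply: G_cont1; exact: Nn0.
  - move=> t _; apply: (le_trans (ler_normB _ _)); apply: lerD; apply: V_le => //.
    by rewrite mulrN opprK.
apply: ler_wpM2l; last lra.
by rewrite addr_ge0// invr_ge0 ltW.
Qed.

(* Near the pole [z = 0] the function is [phi0 / (1 - e^z)] up to a bounded
   error, and [KI] is the imaginary part of [1 / (1 - e^z)]. *)
Let phi0 := (1 + c)^-1 : R.
Let KI (r th : R) : R := - BI r th / NB r th.
Let th_ (m : nat) : R := m.+1%:R^-1.

Let th_0 : th_ @ \oo --> 0.
Proof. exact: cvg_harmonic. Qed.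

Let th_gt0 m : 0 < th_ m. Proof. by rewrite invr_gt0. Qed.

Let th_le1 m : th_ m <= 1.
Proof. by rewrite /th_ invf_le1// ler1n. Qed.

Let sin_th_gt0 m : 0 < sin (th_ m).
Proof.
apply: sin_gt0_pihalf; rewrite th_gt0/=; apply: (le_lt_trans (th_le1 m)).
have := pihalf_ge1 R; rewrite le_eqVlt => /orP[/eqP e|//].
by have := @cos1_gt0 R; rewrite e cos_pihalf ltxx.
Qed.

Let cos_le_nu (th : R) : 0 <= th <= pi -> cos th <= cos (nu * th).
Proof.
move=> /andP[t0 tpi]; have le : nu * th <= th by rewrite ler_piMl// ltW.
have nt0 : 0 <= nu * th by rewrite mulr_ge0// ltW.
move: le; rewrite le_eqVlt => /orP[/eqP ->//|lt].
by rewrite ltW// ltr_cos// in_itv/= ?t0 ?nt0//= (le_trans (ltW lt)).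
Qed.

Let expR_nu_le (r : R) : (expR (nu * r) - 1) ^+ 2 <= (expR r - 1) ^+ 2.
Proof.
have [r0|r0] := leP 0 r.
  have h1 : 1 <= expR (nu * r) by rewrite -expR0 ler_expR mulr_ge0// ltW.
  have h2 : expR (nu * r) <= expR r by rewrite ler_expR ler_piMl// ltW.
  by rewrite ler_sqr ?nnegrE; lra.
have h1 : expR (nu * r) <= 1 by rewrite -[leRHS]expR0 ler_expR pmulr_rle0// ltW.
have h2 : expR r <= expR (nu * r) by rewrite ler_expR ler_niMl// ltW.
by rewrite -sqrrN -[leRHS]sqrrN ler_sqr ?nnegrE; lra.
Qed.

Let AdiffE (r th : R) : (1 + c - AR r th) ^+ 2 + AI r th ^+ 2 =
  c ^+ 2 * ((1 - expR (- (nu * r))) ^+ 2 + 2 * expR (- (nu * r)) * (1 - cos (nu * th))).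
Proof.
rewrite /AR /AI; have := cos2Dsin2 (nu * th); move: (cos _) (sin _) (expR _) => C S x CS.
transitivity (c ^+ 2 * ((1 - 2 * x * C + x ^+ 2 * (C ^+ 2 + S ^+ 2)))); first by ring.
by rewrite CS; ring.
Qed.

(** Both [1 + c - A = c (1 - e^{- nu z})] and [1 - e^z] vanish to first order at the pole, so their
    quotient stays bounded, here by [c e^n]. This is what cancels the singularity in
    [U - phi0 KI]. *)
Let Adiff_le (n r th : R) : - n <= r <= n -> 0 <= th <= pi ->
  (1 + c - AR r th) ^+ 2 + AI r th ^+ 2 <= c ^+ 2 * expR (2 * n) * NB r th.
Proof.
move=> rn tpi; rewrite AdiffE -[leRHS]mulrA ler_wpM2l ?sqr_ge0// NBE.
have hc := cos_le_nu tpi; have := expR_nu_le r.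
rewrite expRN.
have z0 : 0 < expR (nu * r) := expR_gt0 _.
have q0 : 0 < expR r := expR_gt0 _.
have n0 : 0 <= n by lra.
have hE : expR (2 * n) = expR n * expR n by rewrite mulr_natl mulr2n expRD.
have zn : (expR (nu * r))^-1 <= expR n.
  rewrite -expRN ler_expR.
  have : - (nu * r) <= nu * n by rewrite -mulrN ler_wpM2l ?(ltW nu0)//; lra.
  by move=> /le_trans; apply; rewrite ler_piMl// ltW.
have qn : 1 <= expR r * expR n by rewrite -expRD -expR0 ler_expR; lra.
have e1 : 1 <= expR n by rewrite -expR0 ler_expR.
rewrite hE.
move: hc (cos_geN1 th) (cos_le1 (nu * th)).
have y0 : 0 < (expR (nu * r))^-1 by rewrite invr_gt0.
have zy : expR (nu * r) * (expR (nu * r))^-1 = 1 by rewrite divff// gt_eqF.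
set y := (expR (nu * r))^-1 in zn zy y0 *; clearbody y.
move: zn zy y0 z0 q0 qn e1.
move: (expR (nu * r)) (expR r) (expR n) (cos th) (cos (nu * th)) => z q e C D.
move=> ye zy y0 z0 q0 qe e1 CD C1 D1 hz.
(* A squared modulus [|1 - w|^2] equals [(1 - |w|)^2 + 2 |w| (1 - cos (arg w))]. The radial parts
   are compared here and the angular parts in [h2], with [y = e^{- nu r}], [q = e^r], [e = e^n]. *)
have h1 : (1 - y) ^+ 2 <= e * e * (1 - q) ^+ 2.
  have -> : (1 - y) ^+ 2 = y * y * (z - 1) ^+ 2.
    transitivity ((z * y - y) ^+ 2); first by rewrite zy.
    by ring.
  apply: (@le_trans _ _ (y * y * (q - 1) ^+ 2)).
    by rewrite ler_wpM2l// mulr_ge0// ltW.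
  rewrite -[(1 - q) ^+ 2]sqrrN opprB ler_wpM2r ?sqr_ge0//.
  by apply: ler_pM => //; exact: ltW.
have h2 : 2 * y * (1 - D) <= e * e * (2 * q * (1 - C)).
  have -> : e * e * (2 * q * (1 - C)) = 2 * (e * (q * e)) * (1 - C) by ring.
  apply: ler_pM; [by rewrite mulr_ge0// ltW|lra| |lra].
  rewrite ler_wpM2l//; apply: (le_trans ye); rewrite ler_peMr//; lra.
suff -> : e * e * (1 - 2 * q * C + q ^+ 2) = e * e * (1 - q) ^+ 2 + e * e * (2 * q * (1 - C)).
  exact: lerD.
by ring.
Qed.

(** The difference is the imaginary part of [1 / (A B) - phi0 / B = phi0 (1 + c - A) / (A B)], where
    [Adiff_le] compensates [B]. The bound [th <= pi / 2] gives [|A| >= 1]. *)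
Let U_sub_le (n r th : R) : - n <= r <= n -> 0 < th <= pi / 2 ->
  `|U r th - phi0 * KI r th| <= expR n.
Proof.
move=> rn /andP[th0 thpi].
have pi0 : 0 < pi :> R := pi_gt0 R.
have n1 := nu1; have n0 := nu0; have c0' := c0.
have ntpi : nu * th <= pi / 2 by apply: le_trans thpi; rewrite ler_piMl// ltW.
have NA1 : 1 <= NA r th.
  rewrite NAE; have : 0 <= cos (nu * th).
    apply: cos_ge0_pihalf; rewrite ntpi andbT; apply: (@le_trans _ _ 0); first lra.
    by rewrite mulr_ge0// ltW.
  have : 0 < c * expR (- (nu * r)) by rewrite mulr_gt0// expR_gt0.
  by move: (cos _) (c * _) => C x; nra.
have NB0 : 0 < NB r th by apply: NB_gt0; lra.
have NA0 : 0 < NA r th by lra.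
have NA00 : AR r th ^+ 2 + AI r th ^+ 2 != 0 by rewrite gt_eqF.
have NB00 : BR r th ^+ 2 + BI r th ^+ 2 != 0 by rewrite gt_eqF.
have c10 : 1 + c != 0 by rewrite gt_eqF//; lra.
set a := 1 + c - AR r th; set b := AI r th.
have E : U r th - phi0 * KI r th =
  phi0 * ((- a * (AR r th * BI r th + AI r th * BR r th)
           - b * (AR r th * BR r th - AI r th * BI r th)) / N r th).
  rewrite /U /KI /phi0 /N /NA /NB /DI /a /b; field.
  by rewrite NA00 NB00 c10.
have SQ : (U r th - phi0 * KI r th) ^+ 2 <= expR n ^+ 2.
  (* This is [(Im w)^2 <= |w|^2] for [w] the product of [1 + c - A] and the conjugate of [A B]. *)
  have h : (- a * (AR r th * BI r th + AI r th * BR r th)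
           - b * (AR r th * BR r th - AI r th * BI r th)) ^+ 2 <=
      (a ^+ 2 + b ^+ 2) * N r th.
    have -> : (a ^+ 2 + b ^+ 2) * N r th = (- a * (AR r th * BI r th + AI r th * BR r th)
           - b * (AR r th * BR r th - AI r th * BI r th)) ^+ 2 +
      (a * (AR r th * BR r th - AI r th * BI r th)
        - b * (AR r th * BI r th + AI r th * BR r th)) ^+ 2.
      by rewrite /N /NA /NB; ring.
    by rewrite lerDl sqr_ge0.
  have h2 := @Adiff_le n r th rn (ltac:(by apply/andP; split; lra)).
  have p0 : phi0 ^+ 2 * c ^+ 2 <= 1.
    rewrite -exprMn /phi0 mulrC expr_le1//; first by rewrite ler_pdivrMr; lra.
    by rewrite divr_ge0; lra.
  rewrite E exprMn expr_div_n.
  have N2 : 0 < N r th by rewrite /N mulr_gt0.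
  have e2 : expR n ^+ 2 = expR (2 * n) by rewrite mulr_natl mulr2n expRD expr2.
  apply: (@le_trans _ _ (phi0 ^+ 2 * ((c ^+ 2 * expR (2 * n) * NB r th) * N r th / N r th ^+ 2))).
    rewrite ler_wpM2l ?sqr_ge0// ler_wpM2r ?invr_ge0 ?sqr_ge0//.
    by apply: (le_trans h); rewrite ler_wpM2r// ltW.
  have -> : phi0 ^+ 2 * ((c ^+ 2 * expR (2 * n) * NB r th) * N r th / N r th ^+ 2) =
     (phi0 ^+ 2 * c ^+ 2) * (expR (2 * n) * (NA r th)^-1).
    rewrite /N; field.
    by rewrite !gt_eqF.
  rewrite e2 -[leRHS]mul1r; apply: ler_pM => //.
  - by rewrite mulr_ge0 ?sqr_ge0.
  - by rewrite mulr_ge0 ?expR_ge0// invr_ge0 ltW.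
  - by rewrite ler_piMr ?expR_ge0// invf_le1.
rewrite -(@ler_pXn2r _ 2)// ?nnegrE ?expR_ge0//.
by rewrite real_normK// num_real.
Qed.

(** The primitive is the angle, measured from the vertical, under which the point [e^{i th}] sees
    [e^r] on the real axis. As [th] tends to 0 the viewpoint falls onto 1 and the angle tends to
    [pi / 2] or [- pi / 2] according to the sign of [r]. *)
Let KI_int (n th : R) : 0 < n -> 0 < th < pi ->
  \int[mu]_(r in `[- n, n]) KI r th =
  atan ((expR n - cos th) / sin th) - atan ((expR (- n) - cos th) / sin th).
Proof.
move=> n0 /andP[t0 tpi].
have s0 : 0 < sin th by rewrite sin_gt0_pi// t0.
have pi0 : 0 < pi :> R := pi_gt0 R.
have NB0 r : NB r th != 0 by rewrite gt_eqF// NB_gt0//; lra.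
have cKI r : {for r, continuous (KI^~ th)}.
  have cN : {for r, continuous (NB^~ th)}.
    by rewrite /NB /BR /BI; ct.
  have := NB0 r => ?.
  by rewrite /KI /BI; ct.
apply: (@is_derive_FTC2 R (fun r => atan ((expR r - cos th) / sin th))); first lra.
  by apply: continuous_subspaceT => r; exact: cKI.
move=> r _; eapply is_derive_eq; first by der.
rewrite /KI /NB /BI /BR /GRing.scale /=.
have h := NB0 r; rewrite /NB /BI /BR in h.
have CS := cos2Dsin2 th.
have e : (1 - expR r * cos th) ^+ 2 + (- (expR r * sin th)) ^+ 2 =
  sin th ^+ 2 + (expR r - cos th) ^+ 2.
  transitivity (1 - 2 * expR r * cos th + expR r ^+ 2 * (cos th ^+ 2 + sin th ^+ 2)).
    by ring.
  transitivity (cos th ^+ 2 + sin th ^+ 2 - 2 * expR r * cos th + expR r ^+ 2).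
    by rewrite CS mulr1.
  by ring.
rewrite e; rewrite e in h; field.
by rewrite h gt_eqF.
Qed.

Let atan_lim_gt1 (a : R) : 1 < a -> atan ((a - cos (th_ m)) / sin (th_ m)) @[m --> \oo] --> pi / 2.
Proof.
move=> a1.
have s0 := sin_th_gt0.
have ac m : 0 < a - cos (th_ m) by have := cos_le1 (th_ m); lra.
apply: (@cvg_comp _ _ _ (fun m => (a - cos (th_ m)) / sin (th_ m))
  atan _ (pinfty_nbhs R));
  last exact: cvgy_atan.
apply/gtr0_cvgV0; first by apply: nearW => m; rewrite divr_gt0.
rewrite (_ : unstable.inv_fun _ = fun m => sin (th_ m) / (a - cos (th_ m))); last first.
  by apply/funext => m; rewrite /= invf_div.
have -> : 0 = sin 0 / (a - cos 0) :> R by rewrite sin0 mul0r.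
apply: cvgM; first exact: (continuous_cvg _ (@continuous_sin R 0) th_0).
apply: cvgV; first by rewrite cos0 subr_eq0 gt_eqF.
apply: cvgB; first exact: cvg_cst.
exact: (continuous_cvg _ (@continuous_cos R 0) th_0).
Qed.

Let atan_lim_lt1 (a : R) : a < 1 ->
  atan ((a - cos (th_ m)) / sin (th_ m)) @[m --> \oo] --> - (pi / 2).
Proof.
move=> a1.
have s0 := sin_th_gt0.
have cl : cos (th_ m) @[m --> \oo] --> (1 : R).
  by rewrite -(@cos0 R); exact: (continuous_cvg _ (@continuous_cos R 0) th_0).
have ac : \forall m \near \oo, 0 < cos (th_ m) - a.
  by near=> m; rewrite subr_gt0; near: m; exact: (cvgr_gt _ cl).
suff : - atan ((cos (th_ m) - a) / sin (th_ m)) @[m --> \oo] --> - (pi / 2).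
  apply: cvg_trans; apply: near_eq_cvg; apply: nearW => m.
  by rewrite -atanN -mulNr opprB.
apply: cvgN.
apply: (@cvg_comp _ _ _ (fun m => (cos (th_ m) - a) / sin (th_ m))
  atan _ (pinfty_nbhs R));
  last exact: cvgy_atan.
apply/gtr0_cvgV0.
  by near=> m; rewrite divr_gt0//; near: m.
rewrite (_ : unstable.inv_fun _ = fun m => sin (th_ m) / (cos (th_ m) - a)); last first.
  by apply/funext => m; rewrite /= invf_div.
have -> : 0 = sin 0 / (1 - a) :> R by rewrite sin0 mul0r.
apply: cvgM; first exact: (continuous_cvg _ (@continuous_sin R 0) th_0).
apply: cvgV; first by rewrite subr_eq0 gt_eqF.
by apply: cvgB => //; exact: cvg_cst.
Unshelve. all: end_near. Qed.

Let KI_cont1 (r th : R) : NB r th != 0 -> {for r, continuous (KI^~ th)}.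
Proof.
move=> N0; have cN : {for r, continuous (NB^~ th)} by rewrite /NB /BR /BI; ct.
by rewrite /KI /BI; ct.
Qed.

Let J_cvg (n : R) : 0 < n -> J n (th_ m) @[m --> \oo] --> phi0 * pi.
Proof.
move=> n0.
have pi0 : 0 < pi :> R := pi_gt0 R.
have pi2 : 2 <= pi :> R := pi_ge2 R.
have c0' := c0; have n0' := nu0; have n1' := nu1.
have thP m : 0 < th_ m <= 1 by rewrite th_gt0 th_le1.
have nth m : nu * th_ m < pi.
  apply: (@le_lt_trans _ _ (1 * 1)); last lra.
  by have /andP[? ?] := thP m; apply: ler_pM => //; exact: ltW.
have NB0 r m : NB r (th_ m) != 0.
  by rewrite gt_eqF// NB_gt0//; have /andP[? ?] := thP m; lra.
have N0 r m : N r (th_ m) != 0.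
  by rewrite gt_eqF// N_gt0//; have /andP[? ?] := thP m; lra.
pose F m r := U r (th_ m) - phi0 * KI r (th_ m).
have cint (f : R -> R) : (forall r, {for r, continuous f}) ->
    mu.-integrable `[- n, n] (EFin \o f).
  move=> cf; apply: continuous_compact_integrable; first exact: segment_compact.
  exact: continuous_subspaceT.
have iU m : mu.-integrable `[- n, n] (EFin \o (U^~ (th_ m))).
  by apply: cint => r; exact: U_cont1.
have iK m : mu.-integrable `[- n, n] (EFin \o (KI^~ (th_ m))).
  by apply: cint => r; exact: KI_cont1.
have iK' m : mu.-integrable `[- n, n] (EFin \o (fun r => phi0 * KI r (th_ m))).
  by apply: cint => r; apply: ctM; [exact: ct_cst|exact: KI_cont1].
have iF m : mu.-integrable `[- n, n] (EFin \o F m).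
  by apply: cint => r; apply: ctD; [exact: U_cont1|
    apply: ctN; apply: ctM; [exact: ct_cst|exact: KI_cont1]].
have JE m : J n (th_ m) = \int[mu]_(r in `[- n, n]) F m r +
    phi0 * \int[mu]_(r in `[- n, n]) KI r (th_ m).
  rewrite -RintegralZl// /F RintegralB//.
  by rewrite subrK.
have F0 : \int[mu]_(r in `[- n, n]) F m r @[m --> \oo] --> 0.
  have igE : mu.-integrable `[- n, n] (EFin \o cst (expR n)).
    by apply: cint => r; exact: cvg_cst.
  (* On the real axis both [U] and [KI] vanish away from the pole, so the remainder tends to 0 at
     every [r] except [r = 0]. *)
  have ptw : {ae mu, forall r, `[- n, n]%classic r -> (F m r)%:E @[m --> \oo] --> 0%E}.
    exists [set 0]; split; [exact: measurable_set1|exact: lebesgue_measure_set1|].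
      move=> r /= h; apply: contrapT => r0; apply: h => rn.
      apply: cvg_EFin; first by apply: nearW.
      rewrite /comp/=.
      have NBr0 : NB r 0 != 0.
        rewrite NBE cos0 mulr1 (_ : _ + _ = (1 - expR r) ^+ 2); last by ring.
        by rewrite expf_neq0// subr_eq0 eq_sym -expR0 (inj_eq (@expR_inj R)); apply/eqP.
      have NAr0 : NA r 0 != 0.
        rewrite NAE mulr0 cos0 mulr1 gt_eqF//.
        have : 0 < c * expR (- (nu * r)) by rewrite mulr_gt0// expR_gt0.
        by move: (c * _) => y; nra.
      have Nr0 : N r 0 != 0 by rewrite mulf_neq0.
      have cF : {for 0, continuous (fun th => U r th - phi0 * KI r th)}.
        have cN : {for 0, continuous (N r)} by rewrite /N /NA /NB /AR /AI /BR /BI; ct.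
        have cNB : {for 0, continuous (NB r)} by rewrite /NB /BR /BI; ct.
        by rewrite /U /KI /DI /AR /AI /BR /BI; ct.
      have := continuous_cvg _ cF th_0.
      rewrite /U /KI /DI /AI /BI !mulr0 sin0 !mulr0 oppr0 !mulr0 mul0r
        addr0 oppr0 !mul0r mulr0 subr0.
      exact.
  have ub : {ae mu, forall r, forall m, `[- n, n]%classic r -> (`|(F m r)%:E| <= (expR n)%:E)%E}.
    apply: aeW => r m /= rn; rewrite lee_fin; apply: U_sub_le; first by move: rn; rewrite in_itv.
      by have /andP[? ?] := thP m; lra.
  have [_ _] := @dominated_convergence _ _ R mu `[- n, n]%classic (measurable_itv _)
    (fun m => EFin \o F m) (cst 0%E) (EFin \o cst (expR n))
    (fun m => measurable_int _ (iF m)) (measurable_cst _) ptw igE ub.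
  by rewrite integral0 => h; exact: (fine_cvg h).
have K0 : \int[mu]_(r in `[- n, n]) KI r (th_ m) @[m --> \oo] --> pi.
  have -> : (fun m => \int[mu]_(r in `[- n, n]) KI r (th_ m)) =
    fun m => atan ((expR n - cos (th_ m)) / sin (th_ m))
      - atan ((expR (- n) - cos (th_ m)) / sin (th_ m)).
    by apply/funext => m; rewrite KI_int//; have /andP[? ?] := thP m; lra.
  rewrite [X in _ --> X](_ : pi = pi / 2 - (- (pi / 2))); last by field.
  apply: cvgB; first by apply: atan_lim_gt1; rewrite expR_gt1.
  by apply: atan_lim_lt1; rewrite expR_lt1; lra.
have -> : (fun m => J n (th_ m)) = fun m => \int[mu]_(r in `[- n, n]) F m r +
    phi0 * \int[mu]_(r in `[- n, n]) KI r (th_ m) by apply/funext => m; exact: JE.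
rewrite -[X in _ --> X]add0r; apply: cvgD => //.
by apply: cvgM => //; exact: cvg_cst.
Qed.

Let U_pi (r : R) : U r pi = sin (nu * pi) * (c * expR (- (nu * r))) /
  ((1 + 2 * (c * expR (- (nu * r))) * cos (nu * pi) + (c * expR (- (nu * r))) ^+ 2)
   * (1 + expR r)).
Proof.
have n1 := nu1; have pi0 : 0 < pi :> R := pi_gt0 R.
have e1 : 0 < 1 + expR r by rewrite addr_gt0// expR_gt0.
have NA0 : NA r pi != 0 by rewrite gt_eqF// NA_gt0// gtr_pMl.
have NB0 : NB r pi = (1 + expR r) ^+ 2 by rewrite NBE cospi; ring.
rewrite /U /N -NAE /DI /BI sinpi mulr0 oppr0 mulr0 add0r /BR cospi mulrN1 opprK /AI NB0.
field.
by rewrite NA0 gt_eqF.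
Qed.

(** The bound on the vertical sides does not depend on the height. The line can therefore descend to
    the pole at fixed [n], and only then does [n] grow. *)
Lemma stieltjes_kernel_integral :
  (\int[mu]_r (sin (nu * pi) * (c * expR (- (nu * r))) /
  ((1 + 2 * (c * expR (- (nu * r))) * cos (nu * pi) + (c * expR (- (nu * r))) ^+ 2)
   * (1 + expR r)))%:E)%E = ((1 + c)^-1 * pi)%:E.
Proof.
have n1 := nu1; have n0 := nu0; have c0' := c0; have pi0 : 0 < pi :> R := pi_gt0 R.
have nupi : 0 < nu * pi < pi by rewrite mulr_gt0//= gtr_pMl.
under eq_integral do rewrite -U_pi.
have Npi r : N r pi != 0 by rewrite gt_eqF// N_gt0//; [lra|case/andP: nupi].
have cU r : {for r, continuous (U^~ pi)} by exact: U_cont1.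
have U0 r : 0 <= U r pi.
  rewrite U_pi -NAE; apply: divr_ge0; apply: mulr_ge0.
  - by rewrite ltW// sin_gt0_pi.
  - by rewrite mulr_ge0 ?expR_ge0// ltW.
  - by rewrite ltW// NA_gt0//; case/andP: nupi.
  - by rewrite addr_ge0// expR_ge0.
have Jcv : (J n%:R pi)%:E @[n --> \oo] --> (\int[mu]_r (U r pi)%:E)%E.
  pose B n : set (measurableTypeR R) := `[- n%:R, n%:R]%classic.
  have -> : [set: R] = \bigcup_n B n by rewrite -(bigcup_itvT true false).
  have hh : (\int[mu]_(x in B n) (U x pi)%:E)%E @[n --> \oo] -->
      (\int[mu]_(x in \bigcup_n B n) (U x pi)%:E)%E.
    apply: ge0_nondecreasing_set_cvg_integral.
    - move=> n m nm; apply/subsetPset => x; rewrite /B/= !in_itv/=.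
      have : n%:R <= m%:R :> R by rewrite ler_nat.
      by lra.
    - by move=> i; exact: measurable_itv.
    - move=> i; apply/measurable_EFinP; apply: measurable_funTS.
      by apply: continuous_measurable_fun => r; exact: cU.
    - by move=> i x _; rewrite lee_fin.
  apply: cvg_trans hh; apply: near_eq_cvg; apply: nearW => n.
  rewrite /J /Rintegral fineK//; apply: integrable_fin_num => //.
  apply: continuous_compact_integrable; first exact: segment_compact.
  by apply: continuous_subspaceT => r; exact: cU.
suff Jl : J n%:R pi @[n --> \oo] --> phi0 * pi.
  rewrite -(cvg_lim _ Jcv)//; apply/cvg_lim => //.
  by apply: cvg_EFin; [exact: nearW|exact: Jl].
pose x n : R := expR (- nu) ^+ n.
pose y n : R := expR (- 1) ^+ n.
have ez (z : R) n : expR (- z) ^+ n = expR (- (z * n%:R)).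
  by rewrite -expRM_natr mulNr.
have xc : x n @[n --> \oo] --> 0.
  apply: cvg_expr; rewrite ger0_norm ?expR_ge0// expR_lt1; lra.
have yc : y n @[n --> \oo] --> 0.
  apply: cvg_expr; rewrite ger0_norm ?expR_ge0// expR_lt1; lra.
have x0 n : 0 < x n by rewrite exprn_gt0// expR_gt0.
have y0 n : 0 < y n by rewrite exprn_gt0// expR_gt0.
(* For large [n] each factor of [1 - c e^{- nu r}] times [1 - e^r] at [r = n] and [r = - n] is at
   least half its dominant term in absolute value. Two halves give the 4. *)
have bnd : \forall n \near \oo, `|J n%:R pi - phi0 * pi| <= (4 * y n + 4 / c * x n) * pi.
  near=> n.
  have n_gt0 : 0 < n%:R :> R by rewrite ltr0n; near: n; exact: nbhs_infty_gt.
  have xn1 : x n < (2 * c)^-1.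
    near: n; apply: (cvgr_lt _ xc); rewrite invr_gt0; lra.
  have xn2 : x n < c / 2 by near: n; apply: (cvgr_lt _ xc); lra.
  have yn1 : y n < 1 / 2 by near: n; apply: (cvgr_lt _ yc); lra.
  have M10 : 0 < (4 * y n)^-1 by rewrite invr_gt0 mulr_gt0.
  have M20 : 0 < (4 / c * x n)^-1 by rewrite invr_gt0 !mulr_gt0// invr_gt0.
  have ex : expR (- (nu * n%:R)) = x n by rewrite /x ez.
  have ey : expR (- n%:R) = y n by rewrite /y ez mul1r.
  have ex' : expR (nu * n%:R) = (x n)^-1 by rewrite -ex expRN invrK.
  have ey' : expR n%:R = (y n)^-1 by rewrite -ey expRN invrK.
  have cx : c * x n <= 1 / 2.
    have : c * x n <= c * (2 * c)^-1 by rewrite ler_wpM2l// ltW.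
    by rewrite (_ : c * (2 * c)^-1 = 1 / 2)//; field; rewrite gt_eqF.
  have h1 : (4 * y n)^-1 ^+ 2 <= ((1 - c * expR (- (nu * n%:R))) * (1 - expR n%:R)) ^+ 2.
    rewrite ex ey' -[leRHS]sqrrN -mulrN opprB ler_sqr ?nnegrE ?(ltW M10)//.
      have -> : (4 * y n)^-1 = 1 / 2 * ((y n)^-1 / 2) by field; rewrite gt_eqF.
      apply: ler_pM; [lra|by rewrite divr_ge0// invr_ge0 ltW|lra|].
      have : 2 <= (y n)^-1 by rewrite -[leLHS]invrK lef_pV2 ?posrE//; lra.
      by lra.
    apply: mulr_ge0; first lra.
    by rewrite subr_ge0 invf_ge1//; lra.
  have h2 : (4 / c * x n)^-1 ^+ 2 <= ((1 - c * expR (nu * n%:R)) * (1 - expR (- n%:R))) ^+ 2.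
    have cx2 : 2 <= c / x n by rewrite ler_pdivlMr//; lra.
    rewrite ex' ey -[leRHS]sqrrN -mulNr opprB ler_sqr ?nnegrE ?(ltW M20)//.
      have -> : (4 / c * x n)^-1 = (c / x n / 2) * (1 / 2) by field; rewrite !gt_eqF.
      by apply: ler_pM; lra.
    by apply: mulr_ge0; lra.
  have key m : `|J n%:R pi - J n%:R (th_ m)| <= (4 * y n + 4 / c * x n) * pi.
    have := @J_le n%:R (th_ m) _ _ n_gt0 _ M10 M20 h1 h2.
    rewrite !invrK; apply; rewrite th_gt0/=.
    by have := th_le1 m; have := pi_ge2 R; lra.
  have lim : `|J n%:R pi - J n%:R (th_ m)| @[m --> \oo] --> `|J n%:R pi - phi0 * pi|.
    by apply: cvg_norm; apply: cvgB; [exact: cvg_cst|exact: J_cvg].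
  rewrite -(cvg_lim _ lim)//; apply: limr_le; first by apply/cvg_ex; eexists; exact: lim.
  by apply: nearW => m; exact: key.
apply/subr_cvg0; apply/norm_cvg0P.
apply: (squeeze_cvgr (f := cst 0) (h := fun n => (4 * y n + 4 / c * x n) * pi)).
- by apply: filterS bnd => n h; rewrite normr_ge0.
- exact: cvg_cst.
- rewrite [X in _ --> X](_ : 0 = (4 * 0 + 4 / c * 0) * pi); last by ring.
  by apply: cvgMl; apply: cvgD; apply: cvgMr.
Unshelve. all: end_near. Qed.

End contour.

(** * The Mittag-Leffler function and its Laplace transform *)

Section gamma_function.
Variable R : realType.
Local Notation mu := (@lebesgue_measure R).
Local Notation D := (`]0, +oo[%classic : set (measurableTypeR R)).

Lemma integral_exp (a : R) : 0 < a ->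
  (\int[mu]_(x in D) (expR (- (a * x)))%:E)%E = (a^-1)%:E.
Proof.
move=> a0.
have : (\int[mu]_(x in `[0%R, +oo[) (a * expR (- a * x))%:E = 1)%E.
  rewrite -(integral_exponential_pdf a0) integral_mkcond.
  by under eq_integral do rewrite restrict_EFin.
rewrite -integral_itv_obnd_cbnd; last first.
  apply/measurable_EFinP; apply: measurable_funTS.
  by apply: continuous_measurable_fun => x; ct.
under eq_integral do rewrite EFinM mulNr.
rewrite ge0_integralZl//=; last 2 first.
- apply/measurable_EFinP; apply: measurable_funTS.
  by apply: continuous_measurable_fun => x; ct.
- by rewrite lee_fin ltW.
set I := (\int[mu]_(x in _) _)%E => h.
have -> : I = (a^-1%:E * (a%:E * I))%E by rewrite muleA -EFinM mulVf ?mul1e// gt_eqF.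
by rewrite h mule1.
Qed.

Lemma measurable_gamma_integrand (b s : R) :
  measurable_fun [set: R] (fun x : R => x `^ b * expR (- (s * x))).
Proof.
apply: measurable_funM; first exact: measurable_powR.
by apply: continuous_measurable_fun => x; ct.
Qed.

Lemma powR_le_expR (b : R) : 0 <= b ->
  exists2 C : R, 0 <= C & forall x : R, 0 < x -> x `^ b <= C * expR (x / 2).
Proof.
rewrite le_eqVlt => /orP[/eqP <-|b0].
  exists 1 => // x x0; rewrite powRr0 mul1r -[leLHS]expR0 ler_expR; lra.
(* The constant is [(2 b)^b]: apply [ln y <= y] at [y = x / (2 b)] and multiply by [b]. *)
exists (expR (b * ln (2 * b))); first exact: expR_ge0.
move=> x x0; rewrite /powR gt_eqF// -expRD ler_expR.
have x2b : 0 < x / (2 * b) by rewrite divr_gt0// mulr_gt0.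
have := ln_sublinear x2b; rewrite ln_div ?posrE ?mulr_gt0// => h.
have : b * (ln x - ln (2 * b)) <= b * (x / (2 * b)) by rewrite ler_wpM2l ?ltW.
rewrite (_ : b * (x / (2 * b)) = x / 2); last by field; rewrite gt_eqF.
by rewrite mulrBr; lra.
Qed.

Lemma gamma_integrable (b : R) : 0 <= b ->
  mu.-integrable D (fun x => (x `^ b * expR (- (1 * x)))%:E).
Proof.
move=> b0; have [C C0 hC] := powR_le_expR b0.
apply: (@le_integrable _ _ _ mu D _ _ (fun x => (C * expR (- (2^-1 * x)))%:E)) => //.
- by apply/measurable_EFinP; apply: measurable_funTS; exact: measurable_gamma_integrand.
- move=> x; rewrite /= in_itv/= andbT => x0.
  rewrite lee_fin !ger0_norm ?mulr_ge0 ?powR_ge0 ?expR_ge0//.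
  apply: (le_trans (ler_wpM2r (expR_ge0 _) (hC x x0))).
  rewrite -mulrA ler_wpM2l// -expRD ler_expR; lra.
- apply/integrableP; split.
    apply/measurable_EFinP; apply: measurable_funTS.
    by apply: continuous_measurable_fun => x; ct.
  under eq_integral do rewrite /= ger0_norm ?mulr_ge0 ?expR_ge0// EFinM.
  rewrite ge0_integralZl//=.
  + rewrite integral_exp; first by rewrite -EFinM ltry.
    by rewrite invr_gt0.
  + apply/measurable_EFinP; apply: measurable_funTS.
    by apply: continuous_measurable_fun => x; ct.
Qed.

Lemma GammaE (b : R) : 0 <= b ->
  (Gamma (b + 1))%:E = (\int[mu]_(x in D) (x `^ b * expR (- (1 * x)))%:E)%E.
Proof.
move=> b0; rewrite /Gamma /Rintegral addrK fineK.
  by apply: eq_integral => x _; rewrite mul1r.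
under eq_integral do rewrite -[X in - X]mul1r.
by apply: integrable_fin_num => //; exact: gamma_integrable.
Qed.

(** Only the part of the integral over []c, c + 1[] is kept. The free parameter [c] does the work of
    Stirling's formula: with [c = A^{1 / nu}] and [b = nu h] the bound reads
    [A^h <= e^{c + 1} Gamma (nu h + 1)], uniformly in [h]. *)
Lemma Gamma_ge (b c : R) : 0 <= b -> 0 < c -> c `^ b * expR (- (c + 1)) <= Gamma (b + 1).
Proof.
move=> b0 c0; rewrite -lee_fin GammaE//.
have mG A : measurable_fun (A : set R) (fun x : R => (x `^ b * expR (- (1 * x)))%:E).
  by apply/measurable_EFinP; apply: measurable_funTS; exact: measurable_gamma_integrand.
pose E : set (measurableTypeR R) := `]c, (c + 1)[%classic.
apply: (@le_trans _ _ (\int[mu]_(x in E) (x `^ b * expR (- (1 * x)))%:E)%E).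
  apply: (@le_trans _ _ (\int[mu]_(x in E) (c `^ b * expR (- (c + 1)%R))%:E)%E).
    rewrite integral_cst; last exact: measurable_itv.
    rewrite [X in (_ * X)%E](_ : _ = 1%E); last first.
      rewrite [LHS]lebesgue_measure_itv/= lte_fin ltrDl ltr01.
      by rewrite -EFinD addrAC subrr add0r.
    by rewrite mule1.
  apply: ge0_le_integral.
  - exact: measurable_itv.
  - by move=> x _; rewrite lee_fin mulr_ge0 ?powR_ge0 ?expR_ge0.
  - exact: measurable_cst.
  - exact: mG.
  - move=> x; rewrite /E/= in_itv/= => /andP[cx xc]; rewrite lee_fin.
    apply: ler_pM; rewrite ?powR_ge0 ?expR_ge0//.
      by apply: ge0_ler_powR => //; rewrite ?nnegrE ltW// (lt_trans c0).
    by rewrite ler_expR mul1r lerN2 ltW.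
apply: ge0_subset_integral.
- exact: measurable_itv.
- exact: measurable_itv.
- exact: mG.
- by move=> x _; rewrite lee_fin mulr_ge0 ?powR_ge0 ?expR_ge0.
- by move=> x; rewrite /E/= !in_itv/= andbT => /andP[cx _]; rewrite (lt_trans c0).
Qed.

Lemma Gamma_gt0 (b : R) : 0 <= b -> 0 < Gamma (b + 1).
Proof.
move=> b0; apply: lt_le_trans (Gamma_ge b0 ltr01).
by rewrite mulr_gt0 ?expR_gt0// powR_gt0.
Qed.

Lemma Gamma1 : Gamma (1 : R) = 1.
Proof.
apply: EFin_inj; rewrite -[X in Gamma X]add0r GammaE//.
under eq_integral do rewrite powRr0 mul1r.
by rewrite integral_exp// invr1.
Qed.

Lemma powR_continuous_gt0 (b x : R) : 0 < x -> {for x, continuous (fun y : R => y `^ b)}.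
Proof.
by move=> x0; apply: derivable_continuous; apply: derivable_powR; rewrite in_itv/= x0.
Qed.

Lemma laplace_powR (b s : R) : 0 <= b -> 0 < s ->
  (\int[mu]_(x in D) (x `^ b * expR (- (s * x)))%:E)%E =
  (Gamma (b + 1) / s `^ (b + 1))%:E.
Proof.
move=> b0 s0.
have mG A r : measurable_fun (A : set R) (fun x : R => (x `^ b * expR (- (r * x)))%:E).
  by apply/measurable_EFinP; apply: measurable_funTS; exact: measurable_gamma_integrand.
pose F (x : R) := s * x; pose G (x : R) := x `^ b * expR (- (1 * x)).
have dF (x : R) : is_derive x 1 F s.
  by rewrite /F; eapply is_derive_eq; [der|rewrite /GRing.scale/=; ring].
have F'E : F^`()%classic = fun=> s.
  by apply/funext => x; rewrite derive1E; exact: derive_val.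
have F0 : F 0 = 0 by rewrite /F mulr0.
have sub : (\int[mu]_(x in `[F 0%R, +oo[) (G x)%:E)%E =
   (\int[mu]_(x in `[0%R, +oo[) (((G \o F) * F^`()%classic)%R x)%:E)%E.
  apply: increasing_ge0_integration_by_substitutiony.
  - by move=> x y _ _ xy; rewrite ltr_pM2l.
  - by move=> x _; rewrite F'E; exact: cvg_cst.
  - by rewrite F'E; exact: is_cvg_cst.
  - by rewrite F'E; exact: is_cvg_cst.
  - split; first by move=> x _; case: (dF x).
    apply: cvg_at_right_filter; apply: derivable_continuous; by case: (dF 0).
  - apply/cvgryPge => A; near=> x; rewrite /F -ler_pdivrMl//; near: x.
  - have cexp x : {for x, continuous (fun x : R => expR (- (1 * x)))} by ct.
    rewrite F0; apply/continuous_within_itvcyP; split.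
      move=> x; rewrite in_itv/= andbT => x0.
      have : {for x, continuous G} by apply: ctM; [exact: powR_continuous_gt0|exact: cexp].
      exact.
    (* At the endpoint 0 the power is 1 for [b = 0] and 0 for [b > 0], so right-continuity is
       checked in two cases. *)
    rewrite /G; move: b0; rewrite le_eqVlt => /orP[/eqP <-|b0'].
      apply: cvgM; last by apply: cvg_at_right_filter; exact: cexp.
      rewrite [X in _ --> X]powRr0 (_ : (fun x : R => x `^ 0) = cst 1); first exact: cvg_cst.
      by apply/funext => x; rewrite powRr0.
    apply: cvgM; last by apply: cvg_at_right_filter; exact: cexp.
    by rewrite powR0 ?gt_eqF//; exact: powR_cvg0.
  - by move=> x _; rewrite mulr_ge0 ?powR_ge0 ?expR_ge0.
have mGF : measurable_fun [set: R] (G \o F).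
  apply: measurableT_comp.
    exact: measurable_gamma_integrand.
  by apply: continuous_measurable_fun => x; case: (dF x) => /derivable_continuous.
rewrite F0 -!integral_itv_obnd_cbnd in sub; last 2 first.
- apply/measurable_EFinP; apply: measurable_funTS.
  by rewrite F'E; apply: measurable_funM => //; exact: measurable_cst.
- exact: mG.
set I := (\int[mu]_(x in _) _)%E.
have sb : 0 < s `^ (b + 1) by rewrite powR_gt0.
have h : (Gamma (b + 1))%:E = ((s `^ (b + 1))%:E * I)%E.
  rewrite GammaE// sub /I -ge0_integralZl//.
  - apply: eq_integral => x; rewrite inE/= in_itv/= andbT => x0.
    rewrite -EFinM F'E; congr (_%:E).
    transitivity (G (s * x) * s) => //.
    rewrite /G mul1r powRM ?(ltW x0) ?(ltW s0)//.
    have sn : (b + 1 == 0) ==> (s != 0) by rewrite (gt_eqF s0) implybT.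
    rewrite (powRD sn) powRr1 ?(ltW s0)//.
    by ring.
  - exact: mG.
  - by move=> x _; rewrite lee_fin mulr_ge0 ?powR_ge0 ?expR_ge0.
  - by rewrite lee_fin ltW.
have -> : I = (((s `^ (b + 1))^-1)%:E * ((s `^ (b + 1))%:E * I))%E.
  by rewrite muleA -EFinM mulVf ?mul1e// gt_eqF.
by rewrite -h -EFinM mulrC.
Unshelve. all: end_near. Qed.

End gamma_function.

(** * Power series with infinite radius of convergence *)

Section entire_series.
Variable R : realType.

(** Infinite radius of convergence, phrased by boundedness of the terms so that it passes easily to
    the differentiated series. *)
Definition entire_coef (a : R ^nat) :=
  forall A : R, 0 < A -> exists K : R, forall h, `|a h| * A ^+ h <= K.

Lemma entire_coef_cvg (a : R ^nat) (x : R) : entire_coef a -> cvgn (pseries a x).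
Proof.
(* Doubling [|x|] produces a geometric majorant of ratio [1 / 2]; adding 1 keeps the radius positive
   at [x = 0]. *)
move=> fa; have A0 : 0 < 2 * `|x| + 1 by rewrite ltr_wpDl// mulr_ge0.
have [K hK] := fa _ A0.
apply: (normed_cvg (V := R)).
apply: (@series_le_cvg R _ (geometric K 2^-1)) => [h|h|h|].
- exact: normr_ge0.
- by rewrite /geometric/= mulr_ge0// (le_trans _ (hK 0%N))// expr0 mulr1.
- rewrite /geometric/= normrM normrX.
  apply: (@le_trans _ _ (`|a h| * ((2 * `|x| + 1) / 2) ^+ h)).
    have x0 := normr_ge0 x.
    by rewrite ler_wpM2l// lerXn2r ?nnegrE//; lra.
  by rewrite exprMn mulrA exprVn ler_wpM2r// invr_ge0.
- by apply: is_cvg_geometric_series; rewrite ger0_norm ?invf_lt1//; lra.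
Qed.

Lemma entire_coef_diffs (a : R ^nat) : entire_coef a -> entire_coef (pseries_diffs a).
Proof.
move=> fa A A0; have A20 : 0 < 2 * A by rewrite mulr_gt0.
(* The factor [h + 1] from differentiation is at most [2^{h + 1}], absorbed by the radius [2 A];
   dividing by [A] corrects the shift of index. *)
have [K hK] := fa _ A20; exists (K / A) => h.
rewrite /pseries_diffs normrM ger0_norm// ler_pdivlMr//.
apply: le_trans (hK h.+1).
rewrite [leLHS](_ : _ = h.+1%:R * (`|a h.+1| * A ^+ h.+1)); last by rewrite exprSr; ring.
rewrite exprMn mulrCA ler_wpM2l// ler_wpM2r ?mulr_ge0 ?exprn_ge0 ?(ltW A0)//.
by rewrite -natrX ler_nat ltnW// ltn_expl.
Qed.

Lemma entire_coef_continuous (a : R ^nat) : entire_coef a ->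
  continuous (fun x : R => limn (pseries a x)).
Proof.
move=> fa x; apply: derivable_continuous.
have := @pseries_snd_diffs R a (`|x| + 1) x
  (entire_coef_cvg fa) (entire_coef_cvg (entire_coef_diffs fa))
  (entire_coef_cvg (entire_coef_diffs (entire_coef_diffs fa))).
by move=> h; case: h => //; rewrite [ltRHS]ger0_norm ?ltrDl// addr_ge0.
Qed.

End entire_series.

(** * Termwise transform of the Mittag-Leffler series *)

Section mittag_leffler.
Variables (R : realType) (nu : R).
Hypothesis nu0 : 0 < nu.
Local Notation mu := (@lebesgue_measure R).
Local Notation D := (`]0, +oo[%classic : set (measurableTypeR R)).

Let coef (h : nat) : R := (Gamma (nu * h%:R + 1))^-1.

Let nuh_ge0 h : 0 <= nu * h%:R. Proof. by rewrite mulr_ge0// ltW. Qed.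

Let coef_gt0 h : 0 < coef h. Proof. by rewrite invr_gt0 Gamma_gt0. Qed.

Let entire_coef_ml : entire_coef coef.
Proof.
move=> A A0; pose c := A `^ nu^-1; have c0 : 0 < c by rewrite powR_gt0.
exists (expR (c + 1)) => h.
rewrite gtr0_norm// /coef mulrC ler_pdivrMr ?Gamma_gt0//.
have := Gamma_ge (nuh_ge0 h) c0.
rewrite /c -powRrM mulKf ?gt_eqF// powR_mulrn ?(ltW A0)// expRN.
by rewrite ler_pdivrMr ?expR_gt0// mulrC.
Qed.

Let ml_pseries (x : R) : mittag_leffler nu x = limn (pseries coef x).
Proof.
rewrite /mittag_leffler /pseries; congr (limn (series _)).
by apply/funext => h; rewrite mulrC.
Qed.

Lemma mittag_leffler_cvg (x : R) :
  series (fun h : nat => x ^+ h / Gamma (nu * h%:R + 1)) @ \oo --> mittag_leffler nu x.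
Proof.
have -> : (fun h : nat => x ^+ h / Gamma (nu * h%:R + 1)) = fun h => coef h * x ^+ h.
  by apply/funext => h; rewrite mulrC.
by rewrite ml_pseries; exact: (entire_coef_cvg entire_coef_ml).
Qed.

Lemma mittag_leffler_continuous : continuous (mittag_leffler nu).
Proof.
rewrite (_ : mittag_leffler nu = fun x => limn (pseries coef x)).
  exact: entire_coef_continuous.
by apply/funext => x; rewrite ml_pseries.
Qed.

Lemma mittag_leffler0 : mittag_leffler nu 0 = 1.
Proof.
rewrite -(cvg_lim _ (@mittag_leffler_cvg 0))//; apply/cvg_lim => //.
rewrite -cvg_shiftS; apply: cvg_near_cst; apply: nearW => n.
rewrite /series/= big_nat_recl//= expr0 mulr0 add0r Gamma1 divr1 big1 ?addr0// => i _.
by rewrite expr0n mul0r.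
Qed.

Let u (x : R) := mittag_leffler nu (- (x `^ nu)).

Lemma measurable_mittag_leffler_powR (s : R) :
  measurable_fun [set: R] (fun x => u x * expR (- (s * x))).
Proof.
apply: measurable_funM.
  apply: measurableT_comp.
    by apply: continuous_measurable_fun; exact: mittag_leffler_continuous.
  by apply: measurableT_comp => //; exact: measurable_powR.
by apply: continuous_measurable_fun => x; ct.
Qed.

(** The series alternates, so it is dominated by the sum [g] of its absolute values. That sum
    integrates to a geometric series of ratio [q = s^{- nu}], and [s > 1] is what makes [q < 1]. The
    value is [s^{nu - 1} / (s^nu + 1)]. *)
Lemma laplace_mittag_leffler (s : R) : 1 < s ->
  mu.-integrable D (fun x => (u x * expR (- (s * x)))%:E) /\
  (\int[mu]_(x in D) (u x * expR (- (s * x)))%:E)%E = ((s * (1 + (s `^ nu)^-1))^-1)%:E.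
Proof.
move=> s1; have s0 : 0 < s by lra.
pose q : R := (s `^ nu)^-1.
have q0 : 0 < q by rewrite invr_gt0 powR_gt0.
have q1 : q < 1.
  rewrite invf_lt1 ?powR_gt0// [ltLHS](_ : 1 = 1 `^ nu); last by rewrite powR1.
  by rewrite gt0_ltr_powR// ?nnegrE ltW.
pose b h (x : R) := x `^ (nu * h%:R) * expR (- (s * x)) * coef h.
have b0 h x : 0 <= b h x by rewrite !mulr_ge0 ?powR_ge0 ?expR_ge0// ltW.
have mb h : measurable_fun [set: R] (b h).
  by apply: measurable_funM; [exact: measurable_gamma_integrand|exact: measurable_cst].
have mbE h : measurable_fun D (fun x => (b h x)%:E).
  by apply/measurable_EFinP; apply: measurable_funTS; exact: mb.
have ib h : (\int[mu]_(x in D) (b h x)%:E)%E = (s^-1 * q ^+ h)%:E.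
  under eq_integral do rewrite EFinM muleC.
  rewrite ge0_integralZl//.
  - rewrite laplace_powR// -EFinM /coef; congr (_%:E).
    have sn : (nu * h%:R + 1 == 0) ==> (s != 0) by rewrite (gt_eqF s0) implybT.
    rewrite (powRD sn) powRr1 ?(ltW s0)// powRrM powR_mulrn ?powR_ge0// /q exprVn.
    by field; rewrite !gt_eqF ?Gamma_gt0 ?exprn_gt0 ?powR_gt0.
  - by apply/measurable_EFinP; apply: measurable_funTS; exact: measurable_gamma_integrand.
  - by move=> x _; rewrite lee_fin mulr_ge0 ?powR_ge0 ?expR_ge0.
  - by rewrite lee_fin ltW.
pose t h (x : R) := (-1) ^+ h * b h x.
have absT h x : `|t h x| = b h x.
  by rewrite /t normrM normrX normrN1 expr1n mul1r ger0_norm.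
pose g (x : R) : \bar R := (\sum_(0 <= h <oo) (b h x)%:E)%E.
have ig : mu.-integrable D g.
  apply/integrableP; split.
    by apply: ge0_emeasurable_sum => // h x _ _; rewrite lee_fin.
  have -> : (\int[mu]_(x in D) `|g x| = \int[mu]_(x in D) g x)%E.
    apply: eq_integral => x _; rewrite gee0_abs//.
    by apply: nneseries_ge0 => h _ _; rewrite lee_fin.
  rewrite integral_nneseries//; last by move=> h x _; rewrite lee_fin.
  under eq_eseriesr do rewrite ib.
  apply: (@le_lt_trans _ _ (s^-1 / (1 - q))%:E); last by rewrite ltry.
  have gc : `|q| < 1 by rewrite ger0_norm// ltW.
  have gs0 h : 0 <= s^-1 * q ^+ h by rewrite mulr_ge0 ?invr_ge0 ?exprn_ge0// ltW.
  apply: lime_le; first by apply: is_cvg_nneseries => h _ _; rewrite lee_fin.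
  apply: nearW => n; rewrite sumEFin lee_fin.
  have <- : limn (series (geometric s^-1 q)) = s^-1 / (1 - q).
    by apply/cvg_lim => //; exact: cvg_geometric_series.
  apply: (@nondecreasing_cvgn_le _ (series (geometric s^-1 q))).
    by apply: nondecreasing_series => h _ _; exact: gs0.
  by apply: is_cvg_geometric_series.
have itb h : mu.-integrable D (fun x => (t h x)%:E).
  apply/integrableP; split.
    apply/measurable_EFinP; apply: measurable_funTS.
    by apply: measurable_funM; [exact: measurable_cst|exact: mb].
  under eq_integral do rewrite abse_EFin absT.
  by rewrite ib ltry.
pose F m (x : R) : \bar R := (\sum_(0 <= h < m) (t h x)%:E)%E.
have iF m : mu.-integrable D (F m) by apply: integrable_sum.
have cvF x : D x -> F m x @[m --> \oo] --> (u x * expR (- (s * x)))%:E.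
  rewrite /= in_itv/= andbT => x0.
  rewrite (_ : F^~ x = fun m =>
    (series (fun h : nat => (- (x `^ nu)) ^+ h / Gamma (nu * h%:R + 1)) m
    * expR (- (s * x)))%:E).
    apply: cvg_EFin; first exact: nearW.
    by apply: cvgM; [exact: mittag_leffler_cvg|exact: cvg_cst].
  apply/funext => m; rewrite /F sumEFin /series/= mulr_suml; congr (_%:E).
  apply: eq_bigr => h _; rewrite /t /b /coef [in RHS]exprNn powRrM powR_mulrn ?powR_ge0//.
  by ring.
have ubF m x : D x -> (`|F m x| <= g x)%E.
  move=> Dx; apply: (@le_trans _ _ (\sum_(0 <= h < m) (b h x)%:E)%E).
    rewrite /F !sumEFin abse_EFin lee_fin.
    apply: (le_trans (ler_norm_sum _ _ _)).
    by apply: ler_sum => h _; rewrite absT.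
  by apply: nneseries_lim_ge => h _ _; rewrite lee_fin.
have mu_ : measurable_fun D (fun x => (u x * expR (- (s * x)))%:E).
  by apply/measurable_EFinP; apply: measurable_funTS; exact: measurable_mittag_leffler_powR.
have [iu _ cvi] := @dominated_convergence _ _ R mu D (measurable_itv _) F _ g
  (fun m => measurable_int _ (iF m)) mu_ (aeW _ cvF) ig (aeW _ (fun x m => ubF m x)).
split; first exact: iu.
rewrite -(cvg_lim _ cvi)//; apply/cvg_lim => //.
rewrite (_ : (fun m => _) = fun m => (series (geometric s^-1 (- q)) m)%:E).
  apply: cvg_EFin; first exact: nearW.
  rewrite (_ : (s * (1 + (s `^ nu)^-1))^-1 = s^-1 / (1 - (- q))).
    by apply: cvg_geometric_series; rewrite normrN ger0_norm// ltW.
  by rewrite opprK invfM.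
apply/funext => m; rewrite /F integral_sum//.
rewrite /series/= -sumEFin; apply: eq_bigr => h _.
under eq_integral do rewrite EFinM.
rewrite integralZl//; last first.
  apply/integrableP; split; first exact: mbE.
  under eq_integral do rewrite abse_EFin ger0_norm//.
  by rewrite ib ltry.
by rewrite ib -EFinM /geometric/= [(- q) ^+ _]exprNn; congr (_%:E); ring.
Qed.

End mittag_leffler.

(** * Uniqueness of Laplace transforms *)

Section laplace_uniqueness.
Variable R : realType.
Local Notation mu := (@lebesgue_measure R).
Local Notation D := (`]0, +oo[%classic : set (measurableTypeR R)).

Let integrable_expM (f : R -> R) (g : R -> R) : measurable_fun [set: R] g ->
  (exists C : R, forall x : R, 0 < x -> `|g x| <= C) ->
  mu.-integrable D (EFin \o f) -> mu.-integrable D (fun x : R => (g x * f x)%:E).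
Proof.
move=> mg [C gC] intf.
apply: (@le_integrable _ _ _ mu D _ _ (fun x : R => (C%:E * (f x)%:E)%E)) => //.
- apply/measurable_EFinP; apply: measurable_funM; first exact: measurable_funTS.
  by apply/measurable_EFinP; exact: (measurable_int _ intf).
- move=> x; rewrite /= in_itv/= andbT => x0; rewrite lee_fin !normrM ler_wpM2r//.
  exact: (le_trans (gC x x0) (ler_norm _)).
- exact: integrableZl.
Qed.

Let integrable_expR_nat (f : R -> R) (n : nat) : mu.-integrable D (EFin \o f) ->
  mu.-integrable D (fun x : R => (expR (- (n%:R * x)) * f x)%:E).
Proof.
move=> intf; apply: integrable_expM => //.
  by apply: continuous_measurable_fun => x; ct.
exists 1 => x x0; rewrite ger0_norm ?expR_ge0// -expR0 ler_expR.
by rewrite oppr_le0 mulr_ge0// ltW.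
Qed.

Let horner_integral (f : R -> R) (p : {poly R}) : mu.-integrable D (EFin \o f) ->
  (forall n : nat, (\int[mu]_(x in D) (expR (- (n%:R * x)) * f x)%:E = 0)%E) ->
  (\int[mu]_(x in D) (p.[expR (- x)] * f x)%:E = 0)%E.
Proof.
move=> intf f0.
have ie n := integrable_expR_nat n intf.
transitivity (\int[mu]_(x in D)
    (\sum_(i < size p) (p`_i)%:E * (expR (- (i%:R * (x : R))) * f x)%:E))%E;
    last first.
  rewrite integral_sum//; last by move=> i; apply: integrableZl.
  by rewrite big1// => i _; rewrite integralZl// f0 mule0.
apply: eq_integral => x _; under eq_bigr do rewrite -EFinM.
rewrite sumEFin horner_coef mulr_suml; congr (_%:E).
apply: eq_bigr => i _; rewrite -expRM_natl mulrN mulrA; congr (_ * _ * _).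
Qed.

(* With [q x = e^{-x}], the polynomial [p] in [q] exceeds [rho > 1] near [x0] and
   takes values in [[0, 1]] away from [x0]: if [f x0 > 0] then the integral of
   [p(q)^n f], which is [0], would grow like [rho^n]. *)
Let laplace_not_gt0 (f : R -> R) (x0 : R) : 0 < x0 ->
  mu.-integrable D (EFin \o f) -> {for x0, continuous f} ->
  (forall n : nat, (\int[mu]_(x in D) (expR (- (n%:R * x)) * f x)%:E = 0)%E) ->
  f x0 <= 0.
Proof.
move=> x00 intf cf f0; rewrite leNgt; apply/negP => fx0.
pose q (x : R) := expR (- x).
have q01 x : 0 < x -> 0 < q x < 1 by move=> ?; rewrite expR_gt0/= expR_lt1; lra.
have /nbhs_ballP[e0 /= e00 he0] : \forall x \near x0, f x0 / 2 < f x.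
  by apply: (cvgr_gt _ cf); lra.
(* Keeping [e] at most [x0] keeps the neighbourhood [E] below inside the half-line. *)
pose e := Num.min e0 x0.
have e_gt0 : 0 < e by rewrite lt_min e00.
have he x : `|x0 - x| < e -> f x0 / 2 < f x.
  by move=> xe; apply: he0; rewrite /ball/= (lt_le_trans xe)// ge_min lexx.
(* This is [q x0 - q (x0 + e)], the smaller of the two gaps of [q] at distance [e]: the left one is
   [q x0 (e^e - 1)], and [e^e + e^{- e} >= 2]. *)
pose dd := q x0 * (1 - expR (- e)).
have dd0 : 0 < dd by rewrite mulr_gt0 ?expR_gt0// subr_gt0 expR_lt1; lra.
have dd1 : dd <= 1.
  have := q01 _ x00; have := expR_gt0 (- e); rewrite /dd; move: (expR _) (q _) => z w; nra.
have far x : e <= `|x0 - x| -> dd ^+ 2 <= (q x - q x0) ^+ 2.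
  move=> ex; rewrite -[leRHS]real_normK ?num_real// lerXn2r ?nnegrE ?(ltW dd0)//.
  have qe a : q (x0 + a) = q x0 * expR (- a) by rewrite /q opprD expRD.
  have qx0 : 0 < q x0 by rewrite expR_gt0.
  have [xx0|xx0] := leP x0 x.
    have ea : e <= x - x0 by move: ex; rewrite distrC ger0_norm// subr_ge0.
    have -> : q x = q x0 * expR (- (x - x0)) by rewrite -qe addrC subrK.
    have : expR (- (x - x0)) <= expR (- e) by rewrite ler_expR lerN2.
    rewrite /dd distrC; move: (expR (- e)) (expR _) (q x0) qx0 => a b c c0 ab.
    by apply: le_trans (ler_norm _); nra.
  have ea : e <= x0 - x by move: ex; rewrite ger0_norm// subr_ge0 ltW.
  have -> : q x = q x0 * expR (x0 - x) by rewrite -[x0 - x]opprK -qe opprB; congr q; lra.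
  have h1 : expR e <= expR (x0 - x) by rewrite ler_expR.
  have h2 : 1 + e <= expR e by exact: expR_ge1Dx.
  have h3 : 1 - e <= expR (- e) by exact: expR_ge1Dx.
  rewrite /dd; move: (expR (- e)) (expR (x0 - x)) (expR e) (q x0) qx0 h1 h2 h3
    => a b c d d0 h1 h2 h3.
  by apply: le_trans (ler_norm _); nra.
have cq : {for x0, continuous q} by rewrite /q; ct.
have /nbhs_ballP[e1 /= e10 he1] : \forall x \near x0, `|q x0 - q x| < dd / 2.
  by move/cvgrPdist_lt: cq; apply; rewrite divr_gt0.
pose r := Num.min e e1.
have r0 : 0 < r by rewrite lt_min e_gt0.
pose E : set (measurableTypeR R) := `](x0 - r), (x0 + r)[%classic.
have EP x : E x -> `|x0 - x| < r.
  by rewrite /E/= in_itv/= => /andP[? ?]; rewrite ltr_norml; apply/andP; split; lra.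
have EsubD : E `<=` D.
  move=> x; rewrite /E/= !in_itv/= andbT => /andP[h _]; apply: le_lt_trans h.
  by rewrite subr_ge0 !ge_min lexx !orbT.
pose rho := 1 + dd ^+ 2 / 4.
have rho1 : 1 < rho by rewrite ltrDl divr_gt0// exprn_gt0.
pose p : {poly R} := (1 + dd ^+ 2 / 2)%:P - ('X - (q x0)%:P) ^+ 2.
have pE x : p.[q x] = 1 + dd ^+ 2 / 2 - (q x - q x0) ^+ 2.
  by rewrite /p !hornerE.
have p0 x : 0 < x -> 0 <= p.[q x].
  move=> xx; rewrite pE; have := q01 _ xx; have := q01 _ x00.
  move: (q x) (q x0) (sqr_ge0 dd) => a b; nra.
(* Three zones. On [E] the polynomial is at least [rho] and [f > f x0 / 2]; outside [E] but within
   [e] of [x0] the product is nonnegative; farther away the power is at most 1 and [- |f|] bounds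
   the product from below. *)
have lb n x : D x -> rho ^+ n * (f x0 / 2) * \1_E x - `|f x| <= (p ^+ n).[q x] * f x.
  rewrite /= in_itv/= andbT => xx; rewrite horner_exp.
  have [ex|ex] := ltP `|x0 - x| e.
    have fx := he _ ex.
    rewrite (gtr0_norm (lt_trans _ fx)) ?divr_gt0//.
    have [xE|xE] := boolP (x \in E).
      rewrite indicE xE mulr1; apply: (@le_trans _ _ (rho ^+ n * (f x0 / 2))).
        by rewrite gerBl; lra.
      have pr : rho <= p.[q x].
        rewrite pE /rho.
        have : `|q x0 - q x| < dd / 2.
          apply: he1; rewrite /ball/=; apply: (lt_le_trans (EP _ _)); first by rewrite inE in xE.
          by rewrite ge_min lexx orbT.
        rewrite ltr_norml => /andP[]; move: (q x) (q x0) => a b; nra.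
      apply: ler_pM; [by rewrite exprn_ge0//; lra|lra| |lra].
      by rewrite lerXn2r// nnegrE ?p0//; lra.
    rewrite indicE (negbTE xE) mulr0 sub0r.
    apply: (@le_trans _ _ 0); first lra.
    by rewrite mulr_ge0 ?exprn_ge0 ?p0//; lra.
  have xE : x \notin E.
    apply/negP; rewrite inE => /EP h; move: ex; apply/negP; rewrite -ltNge.
    by apply: (lt_le_trans h); rewrite ge_min lexx.
  rewrite indicE (negbTE xE) mulr0 sub0r.
  have p1 : p.[q x] <= 1 by rewrite pE; have := far _ ex; have := sqr_ge0 dd; lra.
  rewrite lerNl; apply: (le_trans (ler_norm _)); rewrite normrN normrM.
  by rewrite ler_piMl// ger0_norm ?exprn_ge0 ?p0// exprn_ile1// p0.
have iF n : mu.-integrable D (fun x : R => ((p ^+ n).[q x] * f x)%:E).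
  apply: integrable_expM => //.
    apply: measurableT_comp; last by apply: continuous_measurable_fun => x; rewrite /q; ct.
    by apply: continuous_measurable_fun; exact: continuous_horner.
  exists ((1 + dd ^+ 2 / 2) ^+ n) => x xx; rewrite horner_exp normrX.
  rewrite lerXn2r ?nnegrE//; first by have := sqr_ge0 dd; lra.
  by rewrite ger0_norm ?p0// pE gerBl sqr_ge0.
have iabs : mu.-integrable D (fun x : R => (`|f x|)%:E).
  by apply: (@integrable_abse _ _ _ mu D (EFin \o f)).
have mE : measurable E by exact: measurable_itv.
have i1 : mu.-integrable D (fun x : R => (\1_E x)%:E).
  apply: (@integrableS _ _ _ mu setT) => //.
  exact: (integrable_indic_itv (x0 - r) (x0 + r) false true).
have iG n : mu.-integrable D (fun x : R => (rho ^+ n * (f x0 / 2) * \1_E x)%:E).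
  have := @integrableZl _ _ _ mu D (measurable_itv _) (rho ^+ n * (f x0 / 2)) _ i1.
  exact.
have key n : rho ^+ n * (f x0 / 2) * (2 * r) <= \int[mu]_(x in D) `|f x|.
  have h : \int[mu]_(x in D) (rho ^+ n * (f x0 / 2) * \1_E x - `|f x|) <=
      \int[mu]_(x in D) ((p ^+ n).[q x] * f x).
    apply: le_Rintegral; [exact: measurable_itv| |exact: iF|exact: lb].
    have := @integrableB _ _ _ mu D (measurable_itv _) _ _ (iG n) iabs.
    exact.
  rewrite (@RintegralB _ _ _ mu D (fun x : R => rho ^+ n * (f x0 / 2) * \1_E x)
    (fun x : R => `|f x|) (measurable_itv _) (iG n) iabs) in h.
  rewrite (@RintegralZl _ _ _ mu D (fun x : R => \1_E x) (rho ^+ n * (f x0 / 2))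
    (measurable_itv _) i1) in h.
  have I1 : \int[mu]_(x in D) \1_E x = 2 * r.
    rewrite /Rintegral integral_indic//= setIidl//.
    rewrite lebesgue_measure_itv/= lte_fin ifT; last by lra.
    by rewrite -EFinB/=; lra.
  have I0 : \int[mu]_(x in D) ((p ^+ n).[q x] * f x) = 0.
    by rewrite /Rintegral horner_integral.
  by move: h; rewrite I1 I0 subr_le0.
set M := \int[mu]_(x in D) _ in key.
have rc : M * rho^-1 ^+ n @[n --> \oo] --> M * 0.
  apply: cvgMr; apply: cvg_expr.
  by rewrite ger0_norm ?invr_ge0 ?invf_lt1//; lra.
have kap : 0 < f x0 / 2 * (2 * r) by rewrite !mulr_gt0.
have [N _ hN] : \forall n \near \oo, M * rho^-1 ^+ n < f x0 / 2 * (2 * r).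
  by apply: (cvgr_lt _ rc); rewrite mulr0.
have := hN N (leqnn N); rewrite exprVn ltNge; move/negP; apply.
have rho0 : 0 < rho by apply: lt_trans rho1.
by rewrite ler_pdivlMr ?exprn_gt0//; have := key N; rewrite -mulrA mulrC.
Qed.

(** Integer arguments suffice: in the variable [e^{- x}] they are the moments of a finite signed
    measure on []0, 1[], and polynomials can concentrate at a point. *)
Lemma laplace_unique (f : R -> R) (x0 : R) : 0 < x0 ->
  mu.-integrable D (EFin \o f) -> {for x0, continuous f} ->
  (forall n : nat, (\int[mu]_(x in D) (expR (- (n%:R * x)) * f x)%:E = 0)%E) ->
  f x0 = 0.
Proof.
move=> x00 intf cf f0; apply/eqP; rewrite eq_le laplace_not_gt0//=.
rewrite -oppr_le0; apply: (@laplace_not_gt0 (fun x : R => - f x)) => //.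
- by have := @integrableN _ _ _ mu D _ intf; exact.
- exact: ctN.
- move=> n; under eq_integral do rewrite mulrN -mulN1r EFinM.
  by rewrite integralZl// ?f0 ?mule0//; exact: integrable_expR_nat.
Qed.

End laplace_uniqueness.

(** * Spectral representation of the Mittag-Leffler function *)

Section spectral_representation.
Variables (R : realType) (nu : R).
Hypotheses (nu0 : 0 < nu) (nu1 : nu < 1).
Local Notation mu := (@lebesgue_measure R).
Local Notation D := (`]0, +oo[%classic : set (measurableTypeR R)).

(** The spectral density [sin (nu pi) xi^{nu - 1} / (pi (1 + 2 xi^nu cos (nu pi) + xi^{2 nu}))] at
    [xi = e^r], times the Jacobian [e^r], with numerator and denominator divided by [xi^{2 nu}]. *)
Definition spectral_density (r : R) : R :=
  pi^-1 * (sin (nu * pi) * expR (- (nu * r)) /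
    (1 + 2 * expR (- (nu * r)) * cos (nu * pi) + expR (- (nu * r)) ^+ 2)).

Local Notation k := spectral_density.

Lemma sin_nupi_gt0 : 0 < sin (nu * pi).
Proof.
have pi0 : 0 < pi :> R := pi_gt0 R.
by apply: sin_gt0_pi; rewrite mulr_gt0//= gtr_pMl.
Qed.

Lemma cos_quadratic_gt0 (y : R) : 0 < y -> 0 < 1 + 2 * y * cos (nu * pi) + y ^+ 2.
Proof.
move=> y0; have s0 := sin_nupi_gt0.
have -> : 1 + 2 * y * cos (nu * pi) + y ^+ 2 =
    (1 + y * cos (nu * pi)) ^+ 2 + (y * sin (nu * pi)) ^+ 2.
  have := cos2Dsin2 (nu * pi); move: (cos _) (sin _) => C S CS.
  transitivity (1 + 2 * y * C + y ^+ 2 * (C ^+ 2 + S ^+ 2)); last by ring.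
  by rewrite CS mulr1.
by rewrite ltr_wpDl ?sqr_ge0// exprn_gt0// mulr_gt0.
Qed.

Lemma spectral_density_ge0 r : 0 <= k r.
Proof.
rewrite /k mulr_ge0 ?invr_ge0 ?pi_ge0// divr_ge0//.
  by rewrite mulr_ge0 ?expR_ge0// ltW// sin_nupi_gt0.
by rewrite ltW// cos_quadratic_gt0// expR_gt0.
Qed.

Lemma spectral_density_continuous : continuous k.
Proof.
move=> r; have h := cos_quadratic_gt0 (expR_gt0 (- (nu * r))).
have h0 : 1 + 2 * expR (- (nu * r)) * cos (nu * pi) + expR (- (nu * r)) ^+ 2 != 0.
  by rewrite gt_eqF.
by rewrite /k; ct.
Qed.

Let mk : measurable_fun [set: R] k.
Proof. by apply: continuous_measurable_fun; exact: spectral_density_continuous. Qed.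

(** Translating [r] by [sg] multiplies [e^{- nu r}] by [c = e^{- nu sg}], which is the contour
    kernel up to the factor [1 / pi]. *)
Lemma spectral_stieltjes (sg : R) :
  (\int[mu]_r (k r / (1 + expR (r - sg)))%:E)%E = ((1 + expR (- (nu * sg)))^-1)%:E.
Proof.
pose G (r : R) := k r / (1 + expR (r - sg)).
pose F (r : R) := r + sg.
have dF (x : R) : is_derive x 1 F 1.
  by rewrite /F; eapply is_derive_eq; [der|rewrite /GRing.scale/=; ring].
have F'E : F^`()%classic = fun=> 1.
  by apply/funext => x; rewrite derive1E; exact: derive_val.
have pi0 : 0 < pi :> R := pi_gt0 R.
have e0 r : 0 < 1 + expR (r - sg) by rewrite addr_gt0// expR_gt0.
have sub : (\int[mu]_r (G r)%:E)%E = (\int[mu]_r (((G \o F) * F^`()%classic)%R r)%:E)%E.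
  apply: increasing_ge0_integration_by_substitutionT.
  - by move=> x y xy; rewrite ltrD2r.
  - by rewrite F'E => x; exact: cvg_cst.
  - by rewrite F'E; exact: is_cvg_cst.
  - by rewrite F'E; exact: is_cvg_cst.
  - by move=> x; case: (dF x).
  - apply/cvgrNyPle => A; near=> x; rewrite /F -lerBrDr; near: x.
    by apply: nbhs_ninfty_le; exact: num_real.
  - apply/cvgryPge => A; near=> x; rewrite /F -lerBlDr; near: x.
    by apply: nbhs_pinfty_ge; exact: num_real.
  - move=> r; have ck : {for r, continuous k} := @spectral_density_continuous r.
    have := e0 r; rewrite lt0r => /andP[h _].
    by rewrite /G; ct.
  - by move=> r; rewrite divr_ge0 ?spectral_density_ge0// ltW.
rewrite [LHS]sub.
have c0 : 0 < expR (- (nu * sg)) by exact: expR_gt0.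
have := stieltjes_kernel_integral nu0 nu1 c0; set c := expR _.
set I := (X in X = _ -> _) => HI.
transitivity ((pi^-1)%:E * I)%E; last first.
  rewrite HI -EFinM; congr (_%:E).
  by rewrite mulrCA mulVf ?mulr1// gt_eqF.
rewrite /I -ge0_integralZl//.
- apply: eq_integral => r _; rewrite -EFinM F'E; congr (_%:E).
  transitivity (G (r + sg)); first by rewrite -[RHS]mulr1.
  have Ec : expR (- (nu * (r + sg))) = c * expR (- (nu * r)).
    by rewrite /c -expRD mulrDr opprD addrC.
  by rewrite /G /k addrK Ec invfM !mulrA.
- apply/measurable_EFinP; apply: continuous_measurable_fun => r.
  have h := cos_quadratic_gt0 (mulr_gt0 c0 (expR_gt0 (- (nu * r)))).
  have h0 : (1 + 2 * (c * expR (- (nu * r))) * cos (nu * pi) +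
          (c * expR (- (nu * r))) ^+ 2) * (1 + expR r) != 0.
    by rewrite gt_eqF// mulr_gt0// addr_gt0// expR_gt0.
  by ct.
- move=> r _; rewrite lee_fin; apply: divr_ge0; apply: mulr_ge0.
  + exact: (ltW sin_nupi_gt0).
  + by rewrite mulr_ge0 ?expR_ge0// ltW.
  + by rewrite ltW// cos_quadratic_gt0// mulr_gt0// expR_gt0.
  + by rewrite addr_ge0// expR_ge0.
- by rewrite lee_fin invr_ge0 ltW.
Unshelve. all: end_near. Qed.

(** Total mass as the limit [sg] to infinity of [spectral_stieltjes]: the weight
    [1 / (1 + e^{r - n})] increases to 1, and so does the right-hand side. *)
Lemma spectral_density_integral : (\int[mu]_r (k r)%:E = 1)%E.
Proof.
pose g (n : nat) (r : R) : \bar R := (k r / (1 + expR (r - n%:R)))%:E.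
have e0 (r : R) (n : nat) : 0 < 1 + expR (r - n%:R) by rewrite addr_gt0// expR_gt0.
have mg n : measurable_fun [set: measurableTypeR R] (g n).
  apply/measurable_EFinP; apply: continuous_measurable_fun => r.
  have ck : {for r, continuous k} := @spectral_density_continuous r.
  have := e0 r n; rewrite lt0r => /andP[h _].
  by ct.
have g0 n r : [set: measurableTypeR R] r -> (0 <= g n r)%E.
  by move=> _; rewrite lee_fin divr_ge0 ?spectral_density_ge0// ltW.
have ndg r : [set: measurableTypeR R] r -> {homo g ^~ r : n m / (n <= m)%N >-> (n <= m)%E}.
  move=> _ n m nm; rewrite lee_fin ler_wpM2l ?spectral_density_ge0// lef_pV2 ?posrE//.
  by rewrite lerD2l ler_expR lerD2l lerN2 ler_nat.
have expn (z : R) : 0 < z -> expR (- (z * n%:R)) @[n --> \oo] --> 0.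
  move=> z0; rewrite (_ : (fun n => _) = fun n => expR (- z) ^+ n).
    by apply: cvg_expr; rewrite ger0_norm ?expR_ge0// expR_lt1; lra.
  by apply/funext => n; rewrite -expRM_natr mulNr.
have lg r : limn (g ^~ r) = (k r)%:E.
  apply/cvg_lim => //; apply: cvg_EFin; first exact: nearW.
  rewrite -[X in _ --> X]divr1; apply: cvgM; first exact: cvg_cst.
  apply: cvgV; first exact: oner_neq0.
  rewrite -[X in _ --> X]addr0; apply: cvgD; first exact: cvg_cst.
  rewrite (_ : (fun n => _) = fun n => expR r * expR (- (1 * n%:R))); last first.
    by apply/funext => n; rewrite -expRD mul1r.
  by rewrite -(mulr0 (expR r)); apply: cvgMr; exact: expn.
have := @cvg_monotone_convergence _ _ R mu setT measurableT g mg g0 ndg.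
under [in X in _ --> X]eq_integral do rewrite lg.
move=> cv; rewrite -(cvg_lim _ cv)//; apply/cvg_lim => //.
rewrite (_ : (fun n => _) = fun n : nat => ((1 + expR (- (nu * n%:R)))^-1)%:E); last first.
  by apply/funext => n; rewrite -spectral_stieltjes.
apply: cvg_EFin; first exact: nearW.
rewrite -[X in _ --> X]invr1; apply: cvgV; first exact: oner_neq0.
rewrite -[X in _ --> X]addr0; apply: cvgD; first exact: cvg_cst.
exact: expn.
Qed.

Lemma spectral_density_integrable : mu.-integrable setT (EFin \o k).
Proof.
apply/integrableP; split; first exact/measurable_EFinP.
under eq_integral do rewrite /= ger0_norm ?spectral_density_ge0//.
by rewrite spectral_density_integral ltry.
Qed.

Definition spectral_laplace (x : R) : R := \int[mu]_r (expR (- (x * expR r)) * k r).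

Local Notation v := spectral_laplace.

Let expR_exp_le1 (x r : R) : 0 <= x -> expR (- (x * expR r)) <= 1.
Proof. by move=> x0; rewrite -expR0 ler_expR oppr_le0 mulr_ge0// expR_ge0. Qed.

Let measurable_expR_exp (x : R) :
  measurable_fun [set: R] (fun r : R => expR (- (x * expR r)) * k r).
Proof.
apply: measurable_funM => //.
by apply: continuous_measurable_fun => r; ct.
Qed.

Lemma spectral_laplace_integrable (x : R) : 0 <= x ->
  mu.-integrable setT (fun r : R => (expR (- (x * expR r)) * k r)%:E).
Proof.
move=> x0; apply: (@le_integrable _ _ _ mu setT _ _ (EFin \o k)) => //.
- by apply/measurable_EFinP; exact: measurable_expR_exp.
- move=> r _; rewrite lee_fin normrM ler_piMl// ger0_norm ?expR_ge0//.
  exact: expR_exp_le1.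
- exact: spectral_density_integrable.
Qed.

Lemma spectral_laplaceE (x : R) : 0 <= x ->
  ((v x)%:E = \int[mu]_r (expR (- (x * expR r)) * k r)%:E)%E.
Proof.
move=> x0; rewrite /v /Rintegral fineK//.
by apply: integrable_fin_num => //; exact: spectral_laplace_integrable.
Qed.

Lemma spectral_laplace0 : v 0 = 1.
Proof.
apply: EFin_inj; rewrite spectral_laplaceE// -spectral_density_integral.
by apply: eq_integral => r _; rewrite mul0r oppr0 expR0 mul1r.
Qed.

Lemma spectral_laplace_ge0 (x : R) : 0 <= v x.
Proof. by apply: Rintegral_ge0 => r _; rewrite mulr_ge0 ?expR_ge0 ?spectral_density_ge0. Qed.

Lemma spectral_laplace_le1 (x : R) : 0 <= x -> v x <= 1.
Proof.
move=> x0; rewrite -lee_fin spectral_laplaceE// -spectral_density_integral.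
apply: ge0_le_integral => //.
- by move=> r _; rewrite lee_fin mulr_ge0 ?expR_ge0 ?spectral_density_ge0.
- by apply/measurable_EFinP; exact: measurable_expR_exp.
- exact/measurable_EFinP.
- by move=> r _; rewrite lee_fin ler_piMl ?spectral_density_ge0// expR_exp_le1.
Qed.

Lemma spectral_laplace_continuous (x : R) : 0 < x -> {for x, continuous v}.
Proof.
move=> x0.
have gt0 (y : R) : `]0, (x + 1)[%classic y -> 0 <= y by rewrite /= in_itv/= => /andP[/ltW].
apply: (@continuity_under_integral R _ _ mu (fun x r : R => expR (- (x * expR r)) * k r)
  setT measurableT 0 (x + 1) _ _ k spectral_density_integrable _ x).
- by move=> y /gt0 y0; exact: spectral_laplace_integrable.
- apply: aeW => r _ y _.
  have : {for y, continuous (fun y : R => expR (- (y * expR r)) * k r)} by ct.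
  exact.
- move=> y /gt0 y0; apply: aeW => r _; rewrite normrM [`|k r|]ger0_norm ?spectral_density_ge0//.
  by rewrite ler_piMl ?spectral_density_ge0// ger0_norm ?expR_ge0// expR_exp_le1.
- by rewrite inE/= in_itv/= x0 ltrDl ltr01.
Qed.

Lemma laplace_spectral_laplace (s : R) : 0 < s ->
  (\int[mu]_(x in D) (v x * expR (- (s * x)))%:E = ((s * (1 + (s `^ nu)^-1))^-1)%:E)%E.
Proof.
move=> s0.
(* The indicator carries the half-line, so that Tonelli applies on the whole product. *)
pose h (p : measurableTypeR R * measurableTypeR R) : \bar R :=
  (\1_D p.1 * (expR (- ((s + expR p.2) * p.1)) * k p.2))%:E.
have mh : measurable_fun [set: measurableTypeR R * measurableTypeR R] h.
  apply/measurable_EFinP; apply: measurable_funM.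
    by apply: measurableT_comp; [exact: measurable_indic|exact: measurable_fst].
  apply: measurable_funM; last exact: measurableT_comp.
  apply: measurableT_comp; first exact: measurable_expR.
  apply: measurableT_comp => //; apply: measurable_funM => //.
  apply: measurable_funD; first exact: measurable_cst.
  by apply: measurableT_comp => //; exact: measurable_expR.
have h0 p : (0 <= h p)%E.
  by rewrite lee_fin mulr_ge0// mulr_ge0 ?expR_ge0// spectral_density_ge0.
have := @fubini_tonelli _ _ _ _ R mu mu h mh h0.
have -> : (\int[mu]_x \int[mu]_y h (x, y) = \int[mu]_(x in D) (v x * expR (- (s * x)))%:E)%E.
  rewrite [RHS]integral_mkcond; apply: eq_integral => x _; rewrite patchE /h /=.
  have [xD|xD] := boolP (x \in D).
    have x0 : 0 < x by move: xD; rewrite inE/= in_itv/= andbT.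
    rewrite EFinM spectral_laplaceE ?(ltW x0)// -ge0_integralZr//.
    + apply: eq_integral => r _; rewrite indicE xD mul1r -EFinM; congr (_%:E).
      by rewrite mulrAC -expRD mulrDl opprD addrC [expR r * x]mulrC.
    + by apply/measurable_EFinP; exact: measurable_expR_exp.
    + by move=> r _; rewrite lee_fin mulr_ge0 ?expR_ge0 ?spectral_density_ge0.
  by apply: integral0_eq => r _; rewrite indicE (negbTE xD) mul0r.
move=> ->.
have se (r : R) : 0 < s + expR r by rewrite addr_gt0// expR_gt0.
(* Integrating in [x] first gives [1 / (s + e^r) = s^{-1} / (1 + e^{r - ln s})], a Stieltjes kernel
   with [sg = ln s], for which [e^{- nu sg} = s^{- nu}]. *)
transitivity (\int[mu]_r (s^-1%:E * (k r / (1 + expR (r - ln s)))%:E))%E.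
  apply: eq_integral => r _.
  transitivity (\int[mu]_(x in D) ((k r)%:E * (expR (- ((s + expR r) * x)))%:E))%E.
    rewrite [RHS]integral_mkcond; apply: eq_integral => x _; rewrite patchE /h /= indicE.
    by case: ifPn => xD; rewrite ?mul1r ?mul0r// -EFinM mulrC.
  rewrite ge0_integralZl//; last 2 first.
  - apply/measurable_EFinP; apply: measurable_funTS.
    by apply: continuous_measurable_fun => x; ct.
  - by rewrite lee_fin spectral_density_ge0.
  rewrite integral_exp// -!EFinM; congr (_%:E).
  rewrite expRD expRN lnK ?posrE//.
  have -> : 1 + expR r / s = (s + expR r) / s by rewrite mulrDl divff// gt_eqF.
  by rewrite invf_div mulrCA mulKf// gt_eqF.
rewrite ge0_integralZl//; last 3 first.
- apply/measurable_EFinP; apply: continuous_measurable_fun => r.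
  have ck : {for r, continuous k} := @spectral_density_continuous r.
  have h1 : 1 + expR (r - ln s) != 0 by rewrite gt_eqF// addr_gt0// expR_gt0.
  by ct.
- by move=> r _; rewrite lee_fin divr_ge0 ?spectral_density_ge0// addr_ge0 ?expR_ge0.
- by rewrite lee_fin invr_ge0 ltW.
rewrite spectral_stieltjes -EFinM; congr (_%:E).
by rewrite invfM expRN /powR gt_eqF.
Qed.

(* Both sides have the same Laplace transform on (1, +oo). *)
Theorem mittag_leffler_spectral (x : R) : 0 <= x ->
  mittag_leffler nu (- (x `^ nu)) = v x.
Proof.
(* Uniqueness speaks of positive points only; at 0 both sides equal 1. *)
rewrite le_eqVlt => /orP[/eqP <-|x0].
  by rewrite powR0 ?gt_eqF// oppr0 mittag_leffler0// spectral_laplace0.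
pose u (x : R) := mittag_leffler nu (- (x `^ nu)).
(* The factor [e^{- 2 x}] makes the difference integrable and turns the arguments [n = 0, 1, ...]
   into [s = 2 + n], inside the range [s > 1]. *)
pose f (x : R) := expR (- (2 * x)) * (u x - v x).
have mv : measurable_fun D v.
  apply: open_continuous_measurable_fun; first exact: interval_open.
  move=> y; rewrite inE/= in_itv/= andbT => y0.
  exact: spectral_laplace_continuous.
have iv (s : R) : 0 < s -> mu.-integrable D (fun x => (v x * expR (- (s * x)))%:E).
  move=> s0; apply/integrableP; split.
    apply/measurable_EFinP; apply: measurable_funM => //; apply: measurable_funTS.
    by apply: continuous_measurable_fun => y; ct.
  under eq_integral do rewrite abse_EFin ger0_norm ?mulr_ge0 ?expR_ge0 ?spectral_laplace_ge0//.
  by rewrite laplace_spectral_laplace// ltry.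
have key (n : nat) : mu.-integrable D (fun x => ((u x - v x) * expR (- ((2 + n%:R) * x)))%:E) /\
   (\int[mu]_(x in D) ((u x - v x) * expR (- ((2 + n%:R) * x)))%:E = 0)%E.
  have s1 : 1 < 2 + n%:R :> R by rewrite ltr_wpDr// ltr1n.
  have s0 : 0 < 2 + n%:R :> R by rewrite (lt_trans _ s1).
  have [iu eu] := laplace_mittag_leffler nu0 s1.
  have := @integrableB _ _ _ mu D (measurable_itv _) _ _ iu (iv _ s0).
  have := @integralB _ _ _ mu D (measurable_itv _) _ _ iu (iv _ s0).
  rewrite eu laplace_spectral_laplace// subee//.
  have E : (fun y => ((u y - v y) * expR (- ((2 + n%:R) * y)))%:E) =
     (fun y => (mittag_leffler nu (- (y `^ nu)) * expR (- ((2 + n%:R) * y)))%:E -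
               (v y * expR (- ((2 + n%:R) * y)))%:E)%E.
    by apply/funext => y; rewrite -EFinB -mulrBl.
  by rewrite E.
have fx : f x = 0.
  apply: laplace_unique => //.
  - have [+ _] := key 0%N; congr (mu.-integrable _ _); apply/funext => y /=.
    by rewrite /f addr0 mulrC.
  - have cv := spectral_laplace_continuous x0.
    have cu : {for x, continuous u}.
      apply: (@ct_comp _ _ (mittag_leffler nu) (fun y => - (y `^ nu))).
        exact: mittag_leffler_continuous.
      by apply: ctN; exact: powR_continuous_gt0.
    by rewrite /f; ct.
  - move=> n; have [_ <-] := key n; apply: eq_integral => y _; congr (_%:E).
    by rewrite /f mulrA -expRD mulrC -opprD -mulrDl [n%:R + 2]addrC.
move/eqP: fx; rewrite /f mulf_eq0 gt_eqF ?expR_gt0//= subr_eq0.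
by move=> /eqP.
Qed.

End spectral_representation.

(** * The law of [W_alpha] *)

Section density.
Variable R : realType.
Local Notation mu := (@lebesgue_measure R).

(** [has_density] only gives probabilities of sets. It makes the law absolutely continuous, and [f]
    agrees almost everywhere with its Radon-Nikodym derivative, for which change of variables
    holds. *)
Lemma expectation_density (d : measure_display) (T : measurableType d) (P : probability T R)
    (X : {RV P >-> R}) (f h : R -> R) :
  measurable_fun [set: R] f -> (forall x, 0 <= f x) ->
  has_density X f ->
  measurable_fun [set: R] h -> (forall x, 0 <= h x) ->
  (\int[P]_w (h (X w))%:E = \int[mu]_x (h x * f x)%:E)%E.
Proof.
move=> mf f0 Xf mh h0.
have mfE : measurable_fun [set: R] (EFin \o f) by exact/measurable_EFinP.
have mhE : measurable_fun [set: R] (EFin \o h) by exact/measurable_EFinP.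
have mX : measurable_fun [set: T] (X : T -> measurableTypeR R).
  by move=> mT Y mY; exact: (@measurable_funPT _ _ _ _ X mT Y mY).
(* The same function as [X], with the codomain on which Lebesgue measure lives, so that the two
   measures can be compared. *)
pose X' : {mfun T >-> measurableTypeR R} :=
  HB.pack_for {mfun T >-> measurableTypeR R} (X : T -> measurableTypeR R)
    (isMeasurableFun.Build _ _ _ _ (X : T -> measurableTypeR R) mX).
pose m := distribution P (X' : {RV P >-> measurableTypeR R}).
have mE A : measurable A -> m A = (\int[mu]_(x in A) (f x)%:E)%E.
  by move=> mA; rewrite -Xf.
have dom : m `<< mu.
  apply/null_content_dominatesP => A mA A0; rewrite mE//.
  by apply: null_set_integral => //; exact: measurable_funTS.
transitivity (\int[m]_x (EFin \o h) x)%E.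
  by rewrite ge0_integral_distribution// => x; rewrite lee_fin.
rewrite -(@Radon_Nikodym_SigmaFinite.change_of_variables _ _ R m mu dom)//.
have ae : ae_eq mu setT (Radon_Nikodym_SigmaFinite.f m mu) (EFin \o f).
  apply: integral_ae_eq => //.
  - exact: Radon_Nikodym_SigmaFinite.f_integrable.
  - by move=> A _ mA;
    have <- := @Radon_Nikodym_SigmaFinite.f_integral _ _ R m mu dom A mA; exact: mE.
apply: ae_eq_integral => //.
- apply: emeasurable_funM => //; apply: (measurable_int mu).
  exact: Radon_Nikodym_SigmaFinite.f_integrable.
- by apply/measurable_EFinP; exact: measurable_funM.
- by apply: filterS ae => x /(_ I) h1 _; rewrite h1 EFinM.
Qed.

Variables nu alpha : R.
Hypotheses (nu0 : 0 < nu) (nu1 : nu < 1) (alpha0 : 0 < alpha).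

Let powR_double (w : R) : w `^ (2 * nu / alpha) = (w `^ (nu / alpha)) ^+ 2.
Proof. by rewrite -powR_mulrn ?powR_ge0// -powRrM -mulrA mulrC. Qed.

Lemma W_density_ge0 w : 0 <= W_density nu alpha w.
Proof.
rewrite /W_density; case: ifPn => // w0.
have h := cos_quadratic_gt0 nu0 nu1 (powR_gt0 (nu / alpha) w0).
rewrite mulr_ge0 ?divr_ge0 ?powR_ge0 ?mulr_ge0 ?pi_ge0 ?(ltW alpha0)//.
  by rewrite ltW// sin_nupi_gt0.
rewrite (_ : w `^ (2 * nu / alpha) + _ + 1 =
    1 + 2 * w `^ (nu / alpha) * cos (nu * pi) + w `^ (nu / alpha) ^+ 2).
  exact: ltW.
by rewrite powR_double; ring.
Qed.

Let W_formula (w : R) := sin (nu * pi) / (alpha * pi) *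
    (w `^ (nu / alpha - 1) /
     (w `^ (2 * nu / alpha) + 2 * w `^ (nu / alpha) * cos (nu * pi) + 1)).

Lemma W_densityE (w : R) : 0 < w -> W_density nu alpha w = W_formula w.
Proof. by rewrite /W_density => ->. Qed.

Let W_formula_continuous (w : R) : 0 < w -> {for w, continuous W_formula}.
Proof.
move=> w0.
have c1 := @powR_continuous_gt0 R (nu / alpha - 1) w w0.
have c2 := @powR_continuous_gt0 R (nu / alpha) w w0.
have c3 := @powR_continuous_gt0 R (2 * nu / alpha) w w0.
have h := cos_quadratic_gt0 nu0 nu1 (powR_gt0 (nu / alpha) w0).
have h0 : w `^ (2 * nu / alpha) + 2 * w `^ (nu / alpha) * cos (nu * pi) + 1 != 0.
  rewrite gt_eqF//; suff -> : w `^ (2 * nu / alpha) = w `^ (nu / alpha) ^+ 2 by lra.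
  exact: powR_double.
by rewrite /W_formula; ct.
Qed.

Let W_density_patch : W_density nu alpha = W_formula \_ `]0, +oo[.
Proof.
apply/funext => w; rewrite patchE /W_density; case: ifPn => w0.
  by rewrite ifT// inE/= in_itv/= w0.
by rewrite ifF//; apply/negbTE; rewrite notin_setE/= in_itv/= andbT; exact/negP.
Qed.

Lemma measurable_W_density : measurable_fun [set: R] (W_density nu alpha).
Proof.
rewrite W_density_patch; apply/(measurable_restrictT _ _).1 => //.
apply: open_continuous_measurable_fun; first exact: interval_open.
by move=> w; rewrite inE/= in_itv/= andbT => w0; exact: W_formula_continuous.
Qed.

Let W_kernel_identity (S C p y f a : R) : a != 0 -> p != 0 -> y != 0 -> f != 0 ->
  1 + 2 * y * C + y ^+ 2 != 0 ->
  S / (a * p) * (y^-1 / f / (y^-1 ^+ 2 + 2 * y^-1 * C + 1)) * (a * f) =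
  p^-1 * (S * y / (1 + 2 * y * C + y ^+ 2)).
Proof.
move=> a0 p0 y0 f0 d0.
have -> : y^-1 ^+ 2 + 2 * y^-1 * C + 1 = (1 + 2 * y * C + y ^+ 2) / y ^+ 2 by field.
field.
by rewrite a0 p0 y0 f0 d0.
Qed.

(** The substitution is made on the compact intervals [[- n, n]], whose images under [F] exhaust the
    positive half-line; monotone convergence does the rest, as [h] and both densities are
    nonnegative. *)
Lemma W_density_substitution (h : R -> R) : continuous h -> (forall w, 0 <= h w) ->
  (\int[mu]_w (h w * W_density nu alpha w)%:E =
   \int[mu]_r (h (expR (alpha * r)) * spectral_density nu r)%R%:E)%E.
Proof.
move=> ch h0.
pose G (w : R) := h w * W_formula w.
pose F (r : R) := expR (alpha * r).
have F0 r : 0 < F r by exact: expR_gt0.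
have dF (x : R) : is_derive x 1 F (alpha * F x).
  by rewrite /F; eapply is_derive_eq; [der|rewrite /GRing.scale/=; ring].
have F'E : F^`()%classic = fun r => alpha * F r.
  by apply/funext => x; rewrite derive1E; exact: derive_val.
have cF : continuous F by move=> r; case: (dF r) => /derivable_continuous.
have cF' : continuous F^`()%classic.
  by rewrite F'E => r; apply: ctM; [exact: ct_cst|exact: cF].
have incF : {homo F : x y / x < y} by move=> x y xy; rewrite ltr_expR ltr_pM2l.
have cG w : 0 < w -> {for w, continuous G}.
  by move=> w0; apply: ctM; [exact: ch|exact: W_formula_continuous].
have sub (n : nat) : (\int[mu]_(w in `[F (- n%:R)%R, F n%:R%R]) (G w)%:E)%E =
  (\int[mu]_(r in `[(- n%:R)%R, n%:R%R]) (h (expR (alpha * r)) * spectral_density nu r)%R%:E)%E.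
  rewrite (@integration_by_substitution_increasing R F G).
  - apply: eq_integral => r _; congr (_%:E); rewrite F'E.
    transitivity (G (F r) * (alpha * F r)) => //.
    rewrite /G -mulrA; congr (_ * _).
    have y0 : 0 < expR (- (nu * r)) by exact: expR_gt0.
    have q0 := cos_quadratic_gt0 nu0 nu1 y0.
    have a0 : alpha != 0 by rewrite gt_eqF.
    (* With [w = e^{alpha r}] every power of [w] in the density becomes a power of [y = e^{- nu r}],
       up to the factor [1 / w] that the Jacobian [alpha w] removes. *)
    have e1 : F r `^ (nu / alpha) = (expR (- (nu * r)))^-1.
      rewrite /F -expRM -expRN opprK; congr expR.
      by field.
    have e2 : F r `^ (2 * nu / alpha) = (expR (- (nu * r)))^-1 ^+ 2.
      by rewrite powR_double e1.
    have e3 : F r `^ (nu / alpha - 1) * F r = (expR (- (nu * r)))^-1.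
      rewrite -e1 -[X in _ * X](powRr1 (ltW (F0 r))) -powRD ?subrK//.
      by rewrite (gt_eqF (F0 r)) implybT.
    have -> : W_formula (F r) * (alpha * F r) =
        sin (nu * pi) / (alpha * pi) * ((expR (- (nu * r)))^-1 / F r /
        ((expR (- (nu * r)))^-1 ^+ 2 + 2 * (expR (- (nu * r)))^-1 * cos (nu * pi) + 1))
        * (alpha * F r).
      have e4 : F r `^ (nu / alpha - 1) = (expR (- (nu * r)))^-1 / F r.
        by rewrite -e3 mulfK// gt_eqF.
      by rewrite /W_formula e1 e2 e4.
    have pin0 : pi != 0 :> R by rewrite gt_eqF// pi_gt0.
    apply: W_kernel_identity => //; rewrite gt_eqF//.
  - by have := ler0n R n; lra.
  - by move=> x y _ _; exact: incF.
  - by move=> x _; exact: cF'.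
  - by apply: cvgP; apply: cvg_at_right_filter; exact: cF'.
  - by apply: cvgP; apply: cvg_at_left_filter; exact: cF'.
  - split; [by move=> x _; case: (dF x)
    |by apply: cvg_at_right_filter; exact: cF
    |by apply: cvg_at_left_filter; exact: cF].
  - apply: continuous_in_subspaceT => w; rewrite inE/= in_itv/= => /andP[w0 _].
    by apply: cG; exact: lt_le_trans w0.
have mG : measurable_fun [set: R] (fun w => h w * W_density nu alpha w).
  apply: measurable_funM; last exact: measurable_W_density.
  exact: continuous_measurable_fun.
have ck r : {for r, continuous (fun r => h (expR (alpha * r)) * spectral_density nu r)}.
  apply: ctM; last exact: spectral_density_continuous.
  by apply: ct_comp => //; exact: cF.
pose A n : set (measurableTypeR R) := `[F (- n%:R), F n%:R]%classic.
pose B n : set (measurableTypeR R) := `[- n%:R, n%:R]%classic.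
have UA : \bigcup_n A n = `]0, +oo[%classic.
  apply/seteqP; split=> [w [n _]|w]; rewrite /A/= !in_itv/= ?andbT => hw.
    by case/andP: hw => hw _; exact: lt_le_trans hw.
  have [n hn] : exists n : nat, `|ln w / alpha| < n%:R.
    by exists (Num.bound `|ln w / alpha|); apply: archi_boundP; exact: normr_ge0.
  exists n => //; rewrite /A/= in_itv/=.
  have -> : w = F (ln w / alpha) by rewrite /F mulrCA mulfV ?gt_eqF// mulr1 lnK.
  by move: hn; rewrite ltr_norml => /andP[? ?]; rewrite /F !ler_expR !ler_pM2l// !ltW.
have UB : \bigcup_n B n = setT by rewrite -(bigcup_itvT true false).
have nat_le (n m : nat) : (n <= m)%N -> n%:R <= m%:R :> R by rewrite ler_nat.
have cA : (\int[mu]_(w in A n) (h w * W_density nu alpha w)%:E)%E @[n --> \oo] -->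
    (\int[mu]_(w in \bigcup_n A n) (h w * W_density nu alpha w)%:E)%E.
  apply: ge0_nondecreasing_set_cvg_integral.
  - move=> n m /nat_le nm; apply/subsetPset => x; rewrite /A/= !in_itv/= => /andP[h1 h2].
    apply/andP; split; [apply: le_trans h1|apply: (le_trans h2)];
      by rewrite /F ler_expR ler_pM2l// lerN2.
  - by move=> i; exact: measurable_itv.
  - by move=> i; apply/measurable_EFinP; apply: measurable_funTS.
  - by move=> i x _; rewrite lee_fin mulr_ge0 ?W_density_ge0.
have cB : (\int[mu]_(r in B n) (h (expR (alpha * r)) * spectral_density nu r)%R%:E)%E
    @[n --> \oo] -->
    (\int[mu]_(r in \bigcup_n B n) (h (expR (alpha * r)) * spectral_density nu r)%R%:E)%E.
  apply: ge0_nondecreasing_set_cvg_integral.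
  - move=> n m /nat_le nm; apply/subsetPset => x; rewrite /B/= !in_itv/= => /andP[h1 h2].
    by apply/andP; split; lra.
  - by move=> i; exact: measurable_itv.
  - move=> i; apply/measurable_EFinP; apply: measurable_funTS.
    by apply: continuous_measurable_fun => r; exact: ck.
  - by move=> i x _; rewrite lee_fin mulr_ge0 ?spectral_density_ge0.
have -> : (\int[mu]_w (h w * W_density nu alpha w)%:E)%E =
    (\int[mu]_(w in \bigcup_n A n) (h w * W_density nu alpha w)%:E)%E.
  rewrite UA [RHS]integral_mkcond; apply: eq_integral => w _; rewrite patchE.
  case: ifPn => //; rewrite notin_setE/= in_itv/= andbT => /negP w0.
  by rewrite /W_density (negbTE w0) mulr0.
rewrite -UB -(cvg_lim _ cA)// -(cvg_lim _ cB)//; congr (limn _).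
apply/funext => n; rewrite -sub; apply: eq_integral => w.
rewrite /A inE/= in_itv/= => /andP[w0 _].
by rewrite W_densityE// (lt_le_trans _ w0).
Qed.

Lemma W_density_pdf : is_pdf (W_density nu alpha).
Proof.
split; [exact: measurable_W_density|exact: W_density_ge0|].
rewrite -(spectral_density_integral nu0 nu1).
transitivity (\int[mu]_w (1 * W_density nu alpha w)%:E)%E.
  by apply: eq_integral => w _; rewrite mul1r.
rewrite (@W_density_substitution (fun=> 1)) => [|w|//]; last exact: cvg_cst.
by apply: eq_integral => r _; rewrite mul1r.
Qed.

End density.

(** * Evaluation at an independent random time *)

Lemma bounded_convergence (d : measure_display) (T : measurableType d)
    (R : realType) (P : probability T R) (f : nat -> T -> R) (g : T -> R) :
  (forall n, measurable_fun [set: T] (f n)) -> measurable_fun [set: T] g ->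
  (forall n w, 0 <= f n w <= 1) ->
  (forall w, f n w @[n --> \oo] --> g w) ->
  (\int[P]_w (f n w)%:E @[n --> \oo] --> \int[P]_w (g w)%:E)%E.
Proof.
move=> mf mg f01 fg.
have [] // := @dominated_convergence _ _ R P [set: T] measurableT
  (fun n w => (f n w)%:E) (fun w => (g w)%:E) (cst 1%:E).
- by move=> n; apply/measurable_EFinP.
- by apply/measurable_EFinP.
- by apply: aeW => w _; apply: cvg_EFin; [exact: nearW|exact: fg].
- exact: finite_measure_integrable_cst.
- apply: aeW => w n _ /=; rewrite lee_fin.
  by have /andP[? ?] := f01 n w; rewrite ger0_norm.
Qed.

Section subordination.
Context (d : measure_display) (T : measurableType d) (R : realType).
Variables (P : probability T R) (X : R -> {mfun T >-> nat}) (tau : {mfun T >-> R}).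
Variables (b : R -> R) (k : nat).

(* The time [tau] is approximated from the right by [g n tau], which takes
   countably many values; independence is used at each of them. *)
Let c (n j : nat) : R := j%:R / n.+1%:R.
Let C (n j : nat) : set T := tau @^-1` `[c n j, c n j.+1[.
Let E (s : R) : set T := [set w | X s w = k].
Let A (n : nat) : set T := \bigcup_j (C n j `&` E (c n j.+1)).
Let g (n : nat) (x : R) : R := c n (Num.truncn (x * n.+1%:R)).+1.

Hypotheses (tau0 : forall w, 0 <= tau w)
  (X_rc : forall w (t : R), 0 <= t -> \forall s \near t^'+, X s w = X t w)
  (X_tau : forall (s : R) (B : set R), 0 < s -> measurable B ->
     (P (E s `&` tau @^-1` B) = P (E s) * P (tau @^-1` B))%E)
  (Xb : forall s : R, 0 < s -> P (E s) = (b s)%:E)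
  (mb : measurable_fun [set: R] b)
  (b_rc : forall x : R, 0 <= x -> b s @[s --> x^'+] --> b x).

Let c_gt0 n j : 0 < c n j.+1. Proof. by rewrite divr_gt0. Qed.

Let mC n j : measurable (C n j).
Proof. by rewrite -[C n j]setTI; exact: measurable_funPT. Qed.

Let mE s : measurable (E s).
Proof.
have -> : E s = X s @^-1` [set k] by [].
by rewrite -[X in measurable X]setTI; exact: measurable_funPT.
Qed.

Let C_trunc n j w : C n j w <-> Num.truncn (tau w * n.+1%:R) = j.
Proof.
rewrite /C /c /= in_itv/= ler_pdivrMr// ltr_pdivlMr//.
split => [/truncn_def//|<-].
by apply: truncn_itv; rewrite mulr_ge0.
Qed.

Let triv_C n : trivIset setT (C n).
Proof. by move=> i j _ _ [w [/C_trunc <- /C_trunc <-]]. Qed.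

Let cover_C n : \bigcup_j C n j = setT.
Proof.
by apply/seteqP; split => // w _; exists (Num.truncn (tau w * n.+1%:R)) => //; apply/C_trunc.
Qed.

(** Strictness matters twice: right limits see only points beyond [x], and the approximating time is
    positive even where [tau = 0], as [Xb] and [X_tau] require. *)
Let g_gt n (x : R) : 0 <= x -> x < g n x.
Proof.
move=> x0; rewrite /g /c ltr_pdivlMr//.
by have /andP[] := @truncn_itv R (x * n.+1%:R) (mulr_ge0 x0 (ler0n _ _)).
Qed.

Let g_cvg (x : R) : 0 <= x -> g n x @[n --> \oo] --> x.
Proof.
move=> x0; apply: (squeeze_cvgr (f := fun=> x) (h := fun n => x + n.+1%:R^-1)).
- apply: nearW => n; rewrite (ltW (g_gt n x0))/= /g /c ler_pdivrMr// mulrDl mulVf//.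
  have /andP[h _] := @truncn_itv R (x * n.+1%:R) (mulr_ge0 x0 (ler0n _ _)).
  by rewrite -natr1 lerD2r.
- exact: cvg_cst.
- rewrite -[X in _ --> X]addr0; apply: cvgD; first exact: cvg_cst.
  exact: cvg_harmonic.
Qed.

Let A_eq n w : A n w <-> X (g n (tau w)) w = k.
Proof.
split => [[j _ [/C_trunc <-]]//|h].
by exists (Num.truncn (tau w * n.+1%:R)) => //; split=> //; apply/C_trunc.
Qed.

Let mA n : measurable (A n).
Proof. by apply: bigcup_measurable => j _; apply: measurableI. Qed.

Let target : set T := [set w | X (tau w) w = k].

Let near_right (Q : set R) (x : R) : 0 <= x -> (\forall s \near x^'+, Q s) ->
  \forall n \near \oo, Q (g n x).
Proof.
move=> x0 [e /= e0 he].
have /cvgrPdist_lt/(_ e e0) := @g_cvg x x0; apply: filterS => n xn.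
by apply: he => //=; exact: g_gt.
Qed.

Let indic_cvg w : \1_(A n) w @[n --> \oo] --> (\1_target w : R).
Proof.
apply: cvg_near_cst; near=> n; rewrite !indicE; congr ((_ : bool)%:R).
have h : X (g n (tau w)) w = X (tau w) w.
  by near: n; exact: (@near_right _ _ _ (@X_rc w _ (tau0 w))).
by apply/idP/idP; rewrite !inE => /=; rewrite A_eq /target/= h.
Unshelve. all: end_near. Qed.

(** Splitting by the exact value of [tau] would be an uncountable union. Instead the indicator is a
    pointwise limit of those of the [A n], each a countable union. *)
Lemma measurable_subordinated : measurable target.
Proof.
have m1 : measurable_fun [set: T] (\1_target : T -> R).
  apply: (measurable_fun_cvg (h := fun n => \1_(A n))) => [n|w _]; last exact: indic_cvg.
  exact: measurable_indic.
have -> : target = [set: T] `&` \1_target @^-1` [set (1 : R)].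
  rewrite setTI; apply/seteqP; split => w; rewrite /= indicE.
    by move=> h; rewrite mem_set.
  by case: (boolP (w \in target)) => [/set_mem//|_ /esym/eqP]; rewrite oner_eq0.
exact: m1.
Qed.

Let b_prob (s : R) : 0 < s -> 0 <= b s <= 1.
Proof.
by move=> s0; rewrite -!lee_fin -Xb// measure_ge0/=; exact: probability_le1.
Qed.

Let g_gt0 n w : 0 < g n (tau w).
Proof. exact: le_lt_trans (g_gt n (tau0 w)). Qed.

Let F n (w : T) : \bar R := (b (g n (tau w)))%:E.

Let mF n : measurable_fun [set: T] (F n).
Proof.
rewrite -(cover_C n); apply/measurable_fun_bigcup => // j.
apply: (eq_measurable_fun (cst (b (c n j.+1))%:E)); last exact: measurable_cst.
by move=> w /set_mem /C_trunc h; rewrite /F /g h.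
Qed.

(** On the cell [C n j] the approximating time is the constant [c n j.+1], so independence applies
    cell by cell and the sum is the integral of a step function. *)
Let prob_A n : (P (A n) = \int[P]_w F n w)%E.
Proof.
rewrite -[in RHS](cover_C n) ge0_integral_bigcup//=; last first.
- by move=> w _; rewrite lee_fin; have /andP[] := b_prob (g_gt0 n w).
- by rewrite cover_C; exact: mF.
rewrite /A measure_bigcup//; last 2 first.
- by move=> j _; exact: measurableI.
- by move=> i j _ _ [w [[/C_trunc <- _] [/C_trunc <- _]]].
transitivity (\sum_(0 <= j <oo) P (C n j `&` E (c n j.+1)))%E.
  by apply: eq_eseriesl => j; rewrite in_setT.
apply: eq_eseriesr => j _.
transitivity (\int[P]_(w in C n j) (b (c n j.+1))%:E)%E.
  by rewrite integral_cst// setIC X_tau ?Xb ?c_gt0.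
by apply: eq_integral => w /set_mem /C_trunc h; rewrite /F /g h.
Qed.

Lemma subordinated_marginal :
  (P [set w | X (tau w) w = k] = \int[P]_w (b (tau w))%:E)%E.
Proof.
have mt : measurable_fun [set: T] (\1_target : T -> R).
  exact/measurable_indic/measurable_subordinated.
have c1 : (\int[P]_w (\1_(A n) w)%:E @[n --> \oo] --> \int[P]_w (\1_target w)%:E)%E.
  apply: bounded_convergence => [n|//|n w|]; last exact: indic_cvg.
    exact/measurable_indic/mA.
  by rewrite indicE; case: (_ \in _); rewrite ?lexx ?ler01.
have c2 : (\int[P]_w F n w @[n --> \oo] --> \int[P]_w (b (tau w))%:E)%E.
  apply: bounded_convergence => [n| |n w|w].
  - by apply/measurable_EFinP; exact: mF.
  - exact: measurableT_comp.
  - exact: b_prob.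
  - apply: (cvg_at_rightP b (tau w) (b (tau w))).1; first exact: b_rc.
    by split=> [n|]; [exact: g_gt|exact: g_cvg].
transitivity (\int[P]_w (\1_target w)%:E)%E.
  by rewrite integral_indic// ?setIT//; exact: measurable_subordinated.
rewrite -(cvg_lim _ c1)// -(cvg_lim _ c2)//; congr (limn _).
apply/funext => n; rewrite integral_indic// setIT.
exact: prob_A.
Qed.

End subordination.

(** * Mixing the spectral representation over the stable time *)

Section mixture.
Context (R : realType) (nu alpha : R).
Hypotheses (nu0 : 0 < nu) (nu1 : nu < 1) (alpha0 : 0 < alpha).
Let mu := @lebesgue_measure R.

Lemma powR_expR_mul (a r : R) : 0 <= a ->
  (a * expR r) `^ alpha = a `^ alpha * expR (alpha * r).
Proof. by move=> a0; rewrite powRM ?expR_ge0// -expRM [r * _]mulrC. Qed.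

Lemma expectation_spectral_laplace (d d' : measure_display)
    (T : measurableType d) (T' : measurableType d')
    (P : probability T R) (Q : probability T' R)
    (Y : {RV P >-> R}) (W : {RV Q >-> R}) (t a : R) :
  (forall w, 0 <= Y w) ->
  (forall z : R, 0 <= z ->
    'E_P[fun w => expR (- (z * Y w))]%E = (expR (- (t * z `^ alpha)))%:E) ->
  has_density W (W_density nu alpha) -> 0 <= a ->
  (\int[P]_w (spectral_laplace nu (a * Y w))%:E =
   'E_Q[fun w => expR (- (t * a `^ alpha * W w))])%E.
Proof.
move=> Y0 Ylap WW a0.
have mk : measurable_fun [set: measurableTypeR R] (spectral_density nu).
  by apply: continuous_measurable_fun; exact: spectral_density_continuous.
pose h (w : R) := expR (- (t * a `^ alpha * w)).
have h_cont : continuous h by move=> w; rewrite /h; ct.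
transitivity (\int[P]_w \int[mu]_r
    (expR (- (a * Y w * expR r)) * spectral_density nu r)%:E)%E.
  by apply: eq_integral => w _; rewrite spectral_laplaceE// mulr_ge0.
rewrite (@fubini_tonelli _ _ _ _ _ P mu (fun wr =>
  (expR (- (a * Y wr.1 * expR wr.2)) * spectral_density nu wr.2)%:E)); last 2 first.
- apply/measurable_EFinP/measurable_funM; last exact: measurableT_comp.
  apply: measurableT_comp => //; apply: measurableT_comp => //.
  apply: measurable_funM; last exact: measurableT_comp.
  by apply: measurable_funM => //; exact: measurableT_comp.
- by move=> wr; rewrite lee_fin mulr_ge0 ?expR_ge0 ?spectral_density_ge0.
transitivity (\int[mu]_r (h (expR (alpha * r)) * spectral_density nu r)%:E)%E.
  apply: eq_integral => r _ /=.
  have ar0 : 0 <= a * expR r by rewrite mulr_ge0 ?expR_ge0.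
  under eq_integral do rewrite EFinM muleC.
  rewrite ge0_integralZl//; last 2 first.
  - apply/measurable_EFinP; apply: measurableT_comp => //; apply: measurableT_comp => //.
    apply: measurable_funM => //; apply: measurable_funM => //.
  - by rewrite lee_fin spectral_density_ge0.
  have := Ylap _ ar0; rewrite expectation.unlock powR_expR_mul// mulrA => yl.
  rewrite /h [RHS]EFinM [RHS]muleC -yl; congr (_ * _)%E; apply: eq_integral => w _.
  by rewrite mulrAC.
rewrite -W_density_substitution//; last by move=> w; exact: expR_ge0.
rewrite -(expectation_density (measurable_W_density _ nu0 nu1) _ WW).
- by rewrite expectation.unlock.
- exact: W_density_ge0.
- exact: continuous_measurable_fun.
- by move=> w; exact: expR_ge0.
Qed.

Lemma integrable_spectral_laplace_comp (d : measure_display)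
    (T : measurableType d) (P : probability T R) (Y : {RV P >-> R}) (a : R) :
  0 <= a -> (forall w, 0 <= Y w) ->
  P.-integrable [set: T] (fun w => (spectral_laplace nu (a * Y w))%:E).
Proof.
move=> a0 Y0.
have aY0 w : 0 <= a * Y w by rewrite mulr_ge0.
have m : measurable_fun [set: T] (fun w => spectral_laplace nu (a * Y w)).
  (* The argument may be 0, whereas continuity of [spectral_laplace] was shown at positive points;
     the Mittag-Leffler form is measurable everywhere. *)
  apply: (eq_measurable_fun (fun w => mittag_leffler nu (- ((a * Y w) `^ nu)))).
    by move=> w _; rewrite mittag_leffler_spectral.
  apply: measurableT_comp.
    by apply: continuous_measurable_fun; exact: mittag_leffler_continuous.
  apply: measurableT_comp => //.
  apply: (measurableT_comp (f := fun x : R => x `^ nu)) => //.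
  exact: measurable_funM.
apply: measurable_bounded_integrable => //; first by rewrite [ltLHS]probability_setT ltry.
exists 1; split => // M M1 w _ /=.
rewrite ger0_norm ?spectral_laplace_ge0//.
by rewrite (le_trans (spectral_laplace_le1 nu0 nu1 (aY0 w)))// ltW.
Qed.

End mixture.

(** * The state probabilities as functions of time *)

Section birth.
Context (R : realType) (nu : R) (lambda : nat -> R).
Hypotheses (nu0 : 0 < nu) (nu1 : nu < 1).
Hypothesis lambda_gt0 : forall k, (1 <= k)%N -> 0 < lambda k.

(** Writing [lambda s^nu = (lambda^{1 / nu} s)^nu] turns each rate into a time scale of one
    function. *)
Lemma birth_probE (s : R) (k : nat) : 0 <= s ->
  birth_prob nu lambda s k = \prod_(1 <= j < k) lambda j *
    \sum_(1 <= m < k.+1) (\prod_(1 <= l < k.+1 | l != m) (lambda l - lambda m))^-1 *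
      spectral_laplace nu (lambda m `^ nu^-1 * s).
Proof.
move=> s0; congr (_ * _); apply: eq_big_nat => m /andP[m1 _].
rewrite mulrC -mittag_leffler_spectral ?mulr_ge0 ?powR_ge0//.
by rewrite powRM ?powR_ge0// -powRrM mulVf ?gt_eqF// powRr1// ltW// lambda_gt0.
Qed.

(** Only the right limit is meant: at 0 a two-sided one would meet the default values of powers of
    negative numbers. *)
Let powR_right (x : R) : 0 <= x -> s `^ nu @[s --> x^'+] --> x `^ nu.
Proof.
rewrite le_eqVlt => /predU1P[<-|x0].
  by rewrite powR0 ?gt_eqF//; exact: powR_cvg0.
exact/cvg_at_right_filter/(@powR_continuous_gt0 R nu x).
Qed.

Lemma birth_prob_right_continuous (k : nat) (x : R) : 0 <= x ->
  birth_prob nu lambda s k @[s --> x^'+] --> birth_prob nu lambda x k.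
Proof.
move=> x0; apply: cvgM; first exact: cvg_cst.
apply: cvg_big => [|m _]; first exact: add_continuous.
apply: cvgM; last exact: cvg_cst.
apply: (cvg_comp (fun s => - (lambda m * s `^ nu)) (mittag_leffler nu));
  last exact: mittag_leffler_continuous.
by apply: cvgN; apply: cvgM; [exact: cvg_cst|exact: powR_right].
Qed.

Lemma measurable_birth_prob (k : nat) :
  measurable_fun [set: R] (fun s : R => birth_prob nu lambda s k).
Proof.
apply: measurable_funM => //; apply: measurable_sum => m.
apply: measurable_funM => //; apply: measurableT_comp.
  by apply: continuous_measurable_fun; exact: mittag_leffler_continuous.
by apply: measurableT_comp => //; apply: measurable_funM.
Qed.

End birth.

(** * Conditioning on the progenitor, and assembly of the law *)

Lemma cond_prob_full (d : measure_display) (T : measurableType d)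
    (R : realType) (P : probability T R) (A B : set T) :
  measurable A -> measurable B -> P B = 1%E -> cond_prob P A B = fine (P A).
Proof.
move=> mA mB PB1; rewrite /cond_prob PB1 divr1.
have -> : (P A = P (A `\` B) + P (A `&` B))%E by exact: measureDI.
suff -> : P (A `\` B) = 0%E by rewrite add0e.
apply/eqP; rewrite -measure_le0.
have <- : P (~` B) = 0%E by rewrite probability_setC// PB1 subee.
apply: le_measure => [| |w []//]; rewrite inE; first exact: measurableD.
exact: measurableC.
Qed.

Theorem mainTheorem11 (R : realType) (d : measure_display)
    (T : measurableType d) (P : probability T R)
    (nu alpha : R) (lambda : nat -> R)
    (N : R -> {RV P >-> nat}) (S : R -> {RV P >-> R}) :
  0 < nu < 1 ->
  0 < alpha <= 1 ->
  (forall k, (1 <= k)%N -> 0 < lambda k) ->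
  (forall j k, (1 <= j)%N -> (1 <= k)%N -> lambda j = lambda k -> j = k) ->
  (fun n : nat => \sum_(1 <= k < n) (lambda k)^-1) @ \oo --> +oo ->
  fractional_pure_birth P nu lambda N ->
  stable_subordinator P alpha S ->
  independent_processes P N S ->
  is_pdf (W_density nu alpha) /\
  forall (d' : measure_display) (T' : measurableType d')
         (Q : probability T' R) (W : {RV Q >-> R}),
    has_density W (W_density nu alpha) ->
  forall (t : R) (k : nat), 0 < t -> (1 <= k)%N ->
    cond_prob P [set w | N (S t w) w = k] [set w | N 0 w = 1%N] =
    \prod_(1 <= j < k) lambda j *
    \sum_(1 <= m < k.+1)
      (\prod_(1 <= l < k.+1 | l != m) (lambda l - lambda m))^-1 *
      fine ('E_Q[fun w => expR (- (t * lambda m `^ (alpha / nu) * W w))])%E.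
Proof.
move=> /andP[nu0 nu1] /andP[alpha0 _] lambda_gt0 _ _ HN HS NS.
split=> [|d' T' Q W HW t k t0 k1]; first exact: W_density_pdf.
have St0 w : 0 <= S t w.
  rewrite -(subordinator_start HS w).
  exact: subordinator_nondecreasing HS w _ _ (lexx _) (ltW t0).
have mA : measurable [set w | N (S t w) w = k].
  exact: measurable_subordinated St0 (birth_right_continuous HN).
have mN0 : measurable [set w | N 0 w = 1%N].
  rewrite (_ : [set w | _] = N 0 @^-1` [set 1%N])//.
  by rewrite -[X in measurable X]setTI; exact: measurable_funPT.
rewrite (cond_prob_full mA mN0 (birth_start HN)).
rewrite (subordinated_marginal St0 (birth_right_continuous HN) _ _
  (measurable_birth_prob lambda nu0 k)
  (@birth_prob_right_continuous _ _ lambda nu0 k)); last 2 first.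
(* Independence of the whole processes is used only for one generating event of each, at the times
   [s] and [t]. *)
- move=> s B s0 mB; apply: NS; apply: sub_sigma_algebra => /=.
    by exists s; [exact: ltW|exists [set k]].
  by exists t; [exact: ltW|exists B].
- by move=> s s0; exact: (birth_state_probabilities HN).
pose a m := lambda m `^ nu^-1.
pose c m := (\prod_(1 <= l < k.+1 | l != m) (lambda l - lambda m))^-1.
(* The exponent [alpha / nu] arises here: the time scale [lambda^{1 / nu}] meets the power [alpha]
   of the stable Laplace exponent. *)
have marg m : (\int[P]_w (spectral_laplace nu (a m * S t w))%:E =
   'E_Q[fun w => expR (- (t * lambda m `^ (alpha / nu) * W w))])%E.
  rewrite (expectation_spectral_laplace nu0 nu1 alpha0 St0 _ HW
    (powR_ge0 _ _) (t := t)); last first.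
    by move=> z z0; exact: (subordinator_laplace HS (ltW t0) z0).
  by rewrite /a -powRrM [nu^-1 * _]mulrC.
have int m : P.-integrable [set: T] (fun w => (spectral_laplace nu (a m * S t w))%:E).
  by apply: integrable_spectral_laplace_comp; rewrite ?powR_ge0.
have int_c m : P.-integrable [set: T] (fun w => (c m * spectral_laplace nu (a m * S t w))%:E).
  by under [X in integrable _ _ X]eq_fun do rewrite EFinM; exact: integrableZl.
transitivity (\int[P]_w (\prod_(1 <= j < k) lambda j *
    \sum_(1 <= m < k.+1) c m * spectral_laplace nu (a m * S t w))).
  by congr fine; apply: eq_integral => w _; rewrite (birth_probE nu0 nu1 lambda_gt0).
rewrite RintegralZl//; last first.
  under [X in integrable _ _ X]eq_fun do rewrite -sumEFin.
  exact: integrable_sum.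
congr (_ * _); rewrite /Rintegral.
under eq_integral do rewrite -sumEFin.
rewrite integral_sum// -sum_fine; last by move=> m _; exact: integrable_fin_num.
apply: eq_bigr => m _; rewrite -marg.
by under eq_integral do rewrite EFinM; rewrite integralZl// fineM//; exact: integrable_fin_num.
Qed.
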